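(* Let $(B_t)_{t\ge 0}$ be a standard Brownian motion (SBM) on a probability space $(\Omega,\mathcal{F},P)$, and let $T\colon \Omega\to[0,\infty]$ be a stopping time with respect to the standard Brownian filtration $(\mathcal{F}_t)_{t\ge 0}$ of $(B_t)_{t\ge 0}$. Define, for $t\ge 0$, $$ B_t^T:=\begin{cases} B_t, & 0\le t\le T,\\ 2B_T-B_t, & t>T. \end{cases} $$ Then $(B_t^T)_{t\ge 0}$ is an SBM.
   Context: A standard Brownian motion (SBM) on a probability space $(\Omega,\mathcal{F},P)$ is a real-valued Gaussian process $(B_t)_{t\ge 0}$ (i.e., all finite-dimensional distributions are multivariate normal distributions) with $B_0=0$, continuous sample paths, $\mathbb{E}[B_t]=0$ for all $t\ge 0$, and covariance function $\mathbb{E}[B_sB_t]=\min(s,t)$ for all $s,t\ge 0$. The standard Brownian filtration $(\mathcal{F}_t)_{t\ge 0}$ is defined as follows: $\mathcal{F}_t$ is the smallest $\sigma$-algebra containing all $P$-null sets for which each $B_s$ ($0\le s\le t$) is measurable. A stopping time with respect to $(\mathcal{F}_t)_{t\ge 0}$ is a mapping $T\colon\Omega\to[0,\infty]$ satisfying $\{T\le t\}\in\mathcal{F}_t$ for each $t\ge 0$; $T$ is allowed to take the value $\infty$ with positive probability. The definition of $B_t^T$ is pointwise in $\omega\in\Omega$: $B_t^T(\omega)=B_t(\omega)$ if $t\le T(\omega)$, and $B_t^T(\omega)=2B_{T(\omega)}(\omega)-B_t(\omega)$ if $t>T(\omega)$ (so $B_t^T(\omega)=B_t(\omega)$ for all $t\ge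 0$ when $T(\omega)=\infty$). *)

(* Defs.v *)
From HB Require Import structures.
From mathcomp Require Import all_boot all_order all_algebra.
From mathcomp Require Import all_classical all_reals all_analysis.

Set Implicit Arguments.
Unset Strict Implicit.
Unset Printing Implicit Defensive.

Import Order.TTheory GRing.Theory Num.Theory.
Import numFieldNormedType.Exports.

Local Open Scope classical_set_scope.
Local Open Scope ring_scope.

(* Processes indexed by [0, +oo[ are functions [B : R -> Omega -> R]; their
   values at negative times are never looked at. *)

(* Normal law with mean [m] and standard deviation [s]. The degenerate case is
   a Dirac mass: [normal_prob m 0] is by convention uniform on [0, 1]. *)
Definition normal_law (R : realType) (m s : R) (A : set R) : \bar R :=
  if s == 0 then \d_m A else normal_prob m s A.

Definition normally_distributed (R : realType) (d : measure_display)
    (Omega : measurableType d) (P : probability Omega R) (X : Omega -> R) :=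
  measurable_fun setT X /\
  exists m s : R, 0 <= s /\
    forall A : set R, measurable A -> pushforward P X A = normal_law m s A.

(* Possibly degenerate multivariate normal distribution: every linear
   combination of the coordinates is (possibly degenerate) normal. *)
Definition multivariate_normal (R : realType) (d : measure_display)
    (Omega : measurableType d) (P : probability Omega R) (n : nat)
    (X : 'I_n -> Omega -> R) :=
  (forall i, measurable_fun setT (X i)) /\
  forall c : 'I_n -> R,
    normally_distributed P (fun w => \sum_(i < n) c i * X i w).

Definition gaussian_process (R : realType) (d : measure_display)
    (Omega : measurableType d) (P : probability Omega R)
    (B : R -> Omega -> R) :=
  forall (n : nat) (t : 'I_n -> R), (forall i, 0 <= t i) ->
    multivariate_normal P (fun i => B (t i)).

Record standard_brownian_motion (R : realType) (d : measure_display)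
    (Omega : measurableType d) (P : probability Omega R)
    (B : R -> Omega -> R) : Prop := StandardBrownianMotion {
  sbm_gaussian : gaussian_process P B ;
  sbm_start : forall w, B 0 w = 0 ;
  sbm_continuous : forall w,
    {within `[0, +oo[, continuous (fun t : R => B t w)} ;
  sbm_mean : forall t : R, 0 <= t -> ('E_P[B t] = 0)%E ;
  sbm_cov : forall s t : R, 0 <= s -> 0 <= t ->
    ('E_P[fun w => (B s w * B t w)%R] = (Num.min s t)%:E)%E
}.

(* The null sets are the measurable sets of probability 0; when [P] is complete
   these are all the negligible sets. *)
Definition brownian_filtration (R : realType) (d : measure_display)
    (Omega : measurableType d) (P : probability Omega R)
    (B : R -> Omega -> R) (t : R) : set (set Omega) :=
  <<s [set N | measurable N /\ P N = 0%E] `|`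
      \bigcup_(s in `[0, t]) preimage_set_system setT (B s) measurable >>.

Definition stopping_time (R : realType) (Omega : Type)
    (F : R -> set (set Omega)) (T : Omega -> \bar R) :=
  (forall w, (0 <= T w)%E) /\
  forall t : R, 0 <= t -> F t [set w | (T w <= t%:E)%E].

Definition reflected (R : realType) (Omega : Type) (B : R -> Omega -> R)
    (T : Omega -> \bar R) (t : R) (w : Omega) : R :=
  if (t%:E <= T w)%E then B t w else 2 * B (fine (T w)) w - B t w.

(* Main.v *)
From HB Require Import structures.
Require Import Defs.
From mathcomp Require Import all_boot all_order all_algebra.
From mathcomp Require Import all_classical all_reals all_analysis.
From mathcomp Require Import measurable_realfun.
From mathcomp Require Import ring lra.

(** For a deterministic time s, put X = sum_i c_i B_(s /\ t_i) and
    Y = sum_i c_i B_(t_i) - X. Reflection at s turns X + Y into X - Y. For every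
    combination l of values of B up to time s, l + Y and l - Y are centred
    normal with the same variance, so E[sin (l + th) sin Y] = 0. The bounded
    functions Z such that E[Z sin (l + th) sin Y] = 0 for all l and th form a
    module over the trigonometric polynomials in the past, closed under bounded
    limits; hence the identity extends to Z = 1_A with A in F_s, and
    E[1_A cos (X - Y + th)] = E[1_A cos (X + Y + th)].
    Rounding T up to a grid and summing this over the events {T_n = s_k} shows
    that B^(T_n) and B have the same trigonometric expectations; by path
    continuity so do B^T and B. These expectations determine the laws of all
    linear combinations. No explicit characteristic function is needed: that
    the mean and the variance determine a normal law follows from affine
    rescaling alone. *)

Set Implicit Arguments.
Unset Strict Implicit.
Unset Printing Implicit Defensive.

Import Order.TTheory GRing.Theory Num.Theory.
Import numFieldNormedType.Exports.

Local Open Scope classical_set_scope.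
Local Open Scope ring_scope.

(** * Elementary limits: polynomial cutoffs and signs of sines *)

Lemma bernoulli_ge (R : realDomainType) (y : R) (n : nat) :
  -1 <= y -> 1 + n%:R * y <= (1 + y) ^+ n.
Proof.
move=> y1; elim: n => [|n IH]; first by rewrite mul0r addr0.
have h : 0 <= n%:R :> R by rewrite ler0n.
have : 0 <= ((1 + y) ^+ n - (1 + n%:R * y)) * (1 + y).
  by apply: mulr_ge0; lra.
have : 0 <= n%:R * y ^+ 2 by rewrite mulr_ge0// sqr_ge0.
by rewrite -natr1 [_ ^+ n.+1]exprS; move: ((1 + y) ^+ n) n%:R => p m hp hm; nra.
Qed.

(** With [q] the square root of [r], Bernoulli's inequality for [1 / q = 1 + h] bounds [n * q ^ n]
    by [1 / h], and the remaining factor [q ^ n] tends to zero. *)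
Lemma cvg_natMexpr (R : realType) (r : R) : 0 <= r < 1 ->
  (fun n : nat => n%:R * r ^+ n) @ \oo --> 0.
Proof.
move=> /andP[r0 r1]; have [->|rn0] := eqVneq r 0.
  by apply: cvg_near_cst; exists 1%N => // -[|n]//= _; rewrite exprS mul0r mulr0.
pose q := Num.sqrt r.
have q0 : 0 < q by rewrite sqrtr_gt0 lt0r rn0.
have qq : q ^+ 2 = r by rewrite sqr_sqrtr.
have q1 : q < 1 by rewrite -sqrtr1 ltr_sqrt.
pose h := q^-1 - 1.
have h0 : 0 < h by rewrite subr_gt0 invf_gt1.
apply: (@squeeze_cvgr _ _ _ _ (cst 0) (fun n => h^-1 * q ^+ n)).
- near=> n; rewrite mulr_ge0 ?exprn_ge0//= -qq -exprM mulnC exprM expr2 mulrA.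
  rewrite ler_wpM2r ?exprn_ge0 ?(ltW q0)//.
  have B : 1 + n%:R * h <= (q ^+ n)^-1.
    have -> : (q ^+ n)^-1 = (1 + h) ^+ n by rewrite addrC subrK exprVn.
    by apply: bernoulli_ge; lra.
  rewrite -(ler_pM2l h0) mulrA [h * _]mulrC divff ?gt_eqF//.
  rewrite -ler_pdivlMr ?exprn_gt0// mul1r; lra.
- exact: cvg_cst.
- rewrite -[X in _ --> X](mulr0 h^-1); apply: cvgMr; apply: cvg_expr.
  by rewrite ger0_norm// ltW.
Unshelve. all: by end_near. Qed.

(* Polynomials that decide whether [x < 1/2]. The factor [n] in the exponent
   makes the limit vanish also at [x = 1/2], where it would otherwise be
   [exp (-1)]. *)
Definition cutoff (R : realType) (n : nat) (x : R) : R :=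
  (1 - x ^+ n) ^+ (n * 2 ^ n).

Lemma cutoff_itv (R : realType) (n : nat) (x : R) :
  0 <= x <= 1 -> 0 <= cutoff n x <= 1.
Proof.
move=> /andP[x0 x1]; have h1 : 0 <= x ^+ n by exact: exprn_ge0.
have h2 : x ^+ n <= 1 by rewrite exprn_ile1.
apply/andP; split; first by rewrite exprn_ge0//; lra.
by rewrite exprn_ile1//; lra.
Qed.

(** Bernoulli's inequality serves on both sides. For [x < 1/2] it bounds the cutoff below by
    [1 - n * (2 * x) ^ n]. For [x >= 1/2] it bounds [(1 + x ^ n) ^ (n * 2 ^ n)] below by [1 + n],
    while the product of this power with the cutoff is at most 1. *)
Lemma cutoff_cvg (R : realType) (x : R) : 0 <= x <= 1 ->
  (fun n => cutoff n x) @ \oo --> ((x < 2^-1)%R%:R : R).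
Proof.
move=> x01; have /andP[x0 x1] := x01; have [xh|xh] := ltP x 2^-1.
- apply: (@squeeze_cvgr _ _ _ _ (fun n => 1 - n%:R * (2 * x) ^+ n) (cst 1)).
  + near=> n; have /andP[_ ->] := cutoff_itv n x01; rewrite andbT.
    apply: le_trans (bernoulli_ge _ _); last first.
      by rewrite lerN2 exprn_ile1.
    by rewrite exprMn natrM natrX mulrN mulrA.
  + rewrite -[X in _ --> X]subr0; apply: cvgB; first exact: cvg_cst.
    by apply: cvg_natMexpr; lra.
  + exact: cvg_cst.
- apply: (@squeeze_cvgr _ _ _ _ (cst 0) (@harmonic R)).
  + near=> n; have /andP[-> _] := cutoff_itv n x01; rewrite /=.
    have y0 : 0 <= x ^+ n by rewrite exprn_ge0.
    have y1 : x ^+ n <= 1 by rewrite exprn_ile1.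
    have B : 1 + (n * 2 ^ n)%:R * x ^+ n <= (1 + x ^+ n) ^+ (n * 2 ^ n).
      by apply: bernoulli_ge; lra.
    have C : 1 + n%:R <= 1 + (n * 2 ^ n)%:R * x ^+ n.
      rewrite lerD2l natrM natrX -mulrA -exprMn ler_peMr// exprn_ege1//; lra.
    have D : cutoff n x * (1 + x ^+ n) ^+ (n * 2 ^ n) <= 1.
      rewrite -exprMn -subr_sqr expr1n exprn_ile1// ?subr_ge0 ?lerBlDr.
      * by rewrite exprn_ile1.
      * by rewrite lerDl exprn_ge0.
    rewrite /harmonic -[leRHS]mul1r ler_pdivlMr ?ltr0n//; apply: le_trans D.
    rewrite ler_wpM2l//; first by have /andP[] := cutoff_itv n x01.
    by rewrite -natr1; lra.
  + exact: cvg_cst.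
  + exact: cvg_harmonic.
Unshelve. all: by end_near. Qed.

(** Once [n] exceeds [|x|], the argument lies strictly between -1 and 1, where sine has the sign of
    its argument. This makes half-lines limits of trigonometric conditions. *)
Lemma sin_div_sign (R : realType) (x : R) :
  \forall n \near \oo, (sin (x / n.+1%:R) < 0) = (x < 0).
Proof.
near=> n.
have n1 : 0 < n.+1%:R :> R by rewrite ltr0n.
have xn : `|x| < n.+1%:R.
  by apply: (@lt_trans _ _ n%:R); [near: n; exact: nbhs_infty_gtr|rewrite ltr_nat].
have [x0|x0|->] := ltgtP x 0.
- rewrite -oppr_gt0 -sinN -mulNr sin2_gt0// divr_gt0 ?oppr_gt0//=.
  by rewrite ltr_pdivrMr//; move: xn; rewrite ltr0_norm//; lra.
- apply/negbTE; rewrite -leNgt ltW// sin2_gt0// divr_gt0//=.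
  by rewrite ltr_pdivrMr//; move: xn; rewrite gtr0_norm//; lra.
- by rewrite mul0r sin0 ltxx.
Unshelve. all: by end_near. Qed.

(** * Bounded measurable functions and functionals on them *)

Definition bounded_mfun d (T : measurableType d) (R : realType) (f : T -> R) :=
  measurable_fun setT f /\ exists C : R, forall w, `|f w| <= C.

Section bounded_mfun.
Context d (T : measurableType d) (R : realType).
Implicit Types (f g : T -> R).

Lemma bounded_mfun_cst (c : R) : bounded_mfun (fun _ : T => c).
Proof. by split; [exact: measurable_cst | exists `|c|]. Qed.

Lemma bounded_mfunM f g : bounded_mfun f -> bounded_mfun g ->
  bounded_mfun (fun w => f w * g w).
Proof.
move=> [mf [C fC]] [mg [D gD]]; split; first exact: measurable_funM.
by exists (C * D) => w; rewrite normrM ler_pM.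
Qed.

Lemma bounded_mfunD f g : bounded_mfun f -> bounded_mfun g ->
  bounded_mfun (fun w => f w + g w).
Proof.
move=> [mf [C fC]] [mg [D gD]]; split; first exact: measurable_funD.
by exists (C + D) => w; rewrite (le_trans (ler_normD _ _))// lerD.
Qed.

Lemma bounded_mfunZD (a : R) f g : bounded_mfun f -> bounded_mfun g ->
  bounded_mfun (fun w => a * f w + g w).
Proof.
move=> bf; apply: bounded_mfunD.
exact: (bounded_mfunM (bounded_mfun_cst a)).
Qed.

Lemma bounded_mfun_cos f : measurable_fun setT f ->
  bounded_mfun (fun w => cos (f w)).
Proof.
move=> mf; split.
  by apply: measurableT_comp => //; apply: continuous_measurable_fun;
    exact: continuous_cos.
by exists 1 => w; rewrite ler_norml cos_geN1 cos_le1.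
Qed.

Lemma bounded_mfun_sin f : measurable_fun setT f ->
  bounded_mfun (fun w => sin (f w)).
Proof.
move=> mf; split.
  by apply: measurableT_comp => //; apply: continuous_measurable_fun;
    exact: continuous_sin.
by exists 1 => w; rewrite ler_norml sin_geN1 sin_le1.
Qed.

Lemma bounded_mfun_indic (A : set T) : measurable A ->
  bounded_mfun (\1_A : T -> R).
Proof.
move=> mA; split; first exact: measurable_indic.
by exists 1 => w; rewrite indicE; case: (_ \in _); rewrite ?normr1 ?normr0.
Qed.

Lemma bounded_mfun_lim (f_ : nat -> T -> R) f (C : R) :
  (forall n, measurable_fun setT (f_ n)) ->
  (forall n w, `|f_ n w| <= C) ->
  (forall w, f_ ^~ w @ \oo --> f w) -> bounded_mfun f.
Proof.
move=> mf fC cf; split.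
  by apply: (measurable_fun_cvg mf) => w _; exact: cf.
exists C => w; rewrite ler_norml.
have cw := cf w; apply/andP; split.
  apply: (@cvgr_to_ge _ _ _ _ _ _ _ cw); apply: nearW => n.
  by have := fC n w; rewrite ler_norml => /andP[].
apply: (@cvgr_to_le _ _ _ _ _ _ _ cw); apply: nearW => n.
by have := fC n w; rewrite ler_norml => /andP[].
Qed.

End bounded_mfun.

(** Vanishing along bounded pointwise limits is all of dominated convergence that the class argument
    uses. The instances are [weighted_functional] and [law_difference_functional]. *)
Record bounded_functional d (T : measurableType d) (R : realType)
    (I : (T -> R) -> R) : Prop := BoundedFunctional {
  functionalZD : forall a f g, bounded_mfun f -> bounded_mfun g ->
    I (fun w => a * f w + g w) = a * I f + I g ;
  functional_lim0 : forall (f_ : nat -> T -> R) f C,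
    (forall n, measurable_fun setT (f_ n)) ->
    (forall n w, `|f_ n w| <= C) ->
    (forall w, f_ ^~ w @ \oo --> f w) ->
    (forall n, I (f_ n) = 0) -> I f = 0
}.

(** * A class argument by multipliers of trigonometric functions *)

Section trigonometric_class.
Context d (T : measurableType d) (R : realType).
Variables (I : (T -> R) -> R) (L : set (T -> R)).
Hypothesis fI : bounded_functional I.
Hypothesis mL : forall l, L l -> measurable_fun setT l.
Hypothesis LD : forall l l', L l -> L l' -> L (fun w => l w + l' w).
Hypothesis LZ : forall a l, L l -> L (fun w => a * l w).

(** The free phase [th] covers sines as well as cosines. *)
Definition annihilated (Z : T -> R) := bounded_mfun Z /\
  forall l (th : R), L l -> I (fun w => Z w * cos (l w + th)) = 0.

(** Multipliers are closed under products, which annihilated functions need not be. Events with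
    multiplier indicators are thus stable under intersection, and a sigma-algebra is reached without
    a pi-lambda argument. *)
Definition multiplier (M : T -> R) := bounded_mfun M /\
  forall Z, annihilated Z -> annihilated (fun w => M w * Z w).

Let bcos l th : L l -> bounded_mfun (fun w => cos (l w + th)).
Proof.
move=> Ll; apply: bounded_mfun_cos; apply: measurable_funD => //.
exact: mL.
Qed.

Lemma functionalZ a f : bounded_mfun f -> I (fun w => a * f w) = a * I f.
Proof.
move=> bf; have b0 := @bounded_mfun_cst _ T R 0.
have I0 : I (fun=> 0) = 0.
  have := functionalZD fI 1 b0 b0.
  under eq_fun do rewrite mulr0 addr0.
  by rewrite mul1r => /eqP; rewrite -subr_eq subrr eq_sym => /eqP.
have := functionalZD fI a bf b0.
by under eq_fun do rewrite addr0; rewrite I0 addr0.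
Qed.

Lemma annihilatedZD a Z Z' : annihilated Z -> annihilated Z' ->
  annihilated (fun w => a * Z w + Z' w).
Proof.
move=> [bZ IZ] [bZ' IZ']; split; first exact: bounded_mfunZD.
move=> l th Ll.
under eq_fun do rewrite mulrDl -mulrA.
rewrite (functionalZD fI)//; first by rewrite IZ// IZ'// mulr0 addr0.
- by apply: bounded_mfunM => //; exact: bcos.
- by apply: bounded_mfunM => //; exact: bcos.
Qed.

Lemma annihilated_lim (Z_ : nat -> T -> R) Z C :
  (forall n w, `|Z_ n w| <= C) -> (forall w, Z_ ^~ w @ \oo --> Z w) ->
  (forall n, annihilated (Z_ n)) -> annihilated Z.
Proof.
move=> ZC cZ aZ; split.
  by apply: (bounded_mfun_lim _ ZC cZ) => n; case: (aZ n) => -[].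
move=> l th Ll.
apply: (functional_lim0 fI (f_ := fun n w => Z_ n w * cos (l w + th)) (C := C)).
- by move=> n; apply: measurable_funM; [case: (aZ n) => -[]|case: (bcos th Ll)].
- move=> n w; rewrite normrM -[leRHS]mulr1 ler_pM//.
  by rewrite ler_norml cos_geN1 cos_le1.
- by move=> w; apply: cvgM => //; exact: cvg_cst.
- by move=> n; case: (aZ n) => _; exact.
Qed.

Lemma multiplier_cst c : multiplier (fun _ => c).
Proof.
split; first exact: bounded_mfun_cst.
move=> Z aZ; have := annihilatedZD (c - 1) aZ aZ.
by under eq_fun do rewrite mulrBl mul1r subrK.
Qed.

Lemma multiplierM M M' : multiplier M -> multiplier M' ->
  multiplier (fun w => M w * M' w).
Proof.
move=> [bM mM] [bM' mM']; split; first exact: bounded_mfunM.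
by move=> Z aZ; under eq_fun do rewrite -mulrA; exact/mM/mM'.
Qed.

Lemma multiplierZD a M M' : multiplier M -> multiplier M' ->
  multiplier (fun w => a * M w + M' w).
Proof.
move=> [bM mM] [bM' mM']; split; first exact: bounded_mfunZD.
move=> Z aZ; under eq_fun do rewrite mulrDl -mulrA.
by apply: annihilatedZD; [exact: mM|exact: mM'].
Qed.

Lemma multiplierX M n : multiplier M -> multiplier (fun w => M w ^+ n).
Proof.
move=> mM; elim: n => [|n IH].
  by under eq_fun do rewrite expr0; exact: multiplier_cst.
by under eq_fun do rewrite exprS; exact: multiplierM.
Qed.

Lemma multiplier_lim (M_ : nat -> T -> R) M C :
  (forall n w, `|M_ n w| <= C) -> (forall w, M_ ^~ w @ \oo --> M w) ->
  (forall n, multiplier (M_ n)) -> multiplier M.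
Proof.
move=> MC cM mM; split.
  by apply: (bounded_mfun_lim _ MC cM) => n; case: (mM n) => -[].
move=> Z aZ; have [[_ [D ZD]] _] := aZ.
apply: (@annihilated_lim (fun n w => M_ n w * Z w) _ (C * D)).
- by move=> n w; rewrite normrM ler_pM.
- by move=> w; apply: cvgM => //; exact: cvg_cst.
- by move=> n; case: (mM n) => _; exact.
Qed.

(* Product-to-sum: cos a cos b = (cos (a + b) + cos (a - b)) / 2 *)
Lemma multiplier_cos l th : L l -> multiplier (fun w => cos (l w + th)).
Proof.
move=> Ll; split; first exact: bcos.
move=> Z [bZ IZ]; split; first by apply: bounded_mfunM => //; exact: bcos.
move=> l' th' Ll'.
have E w : cos (l w + th) * Z w * cos (l' w + th') =
    2^-1 * (Z w * cos (l w + l' w + (th + th'))) +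
    2^-1 * (Z w * cos (l w + -1 * l' w + (th - th'))).
  have -> : l w + l' w + (th + th') = (l w + th) + (l' w + th') by ring.
  have -> : l w + -1 * l' w + (th - th') = (l w + th) - (l' w + th') by ring.
  by move: (l w + th) (l' w + th') => a b; rewrite cosD cosB; field.
under eq_fun do rewrite E.
have L1 := LD Ll Ll'; have L2 := LD Ll (LZ (-1) Ll').
have B1 := bounded_mfunM bZ (bcos (th + th') L1).
have B2 := bounded_mfunM bZ (bcos (th - th') L2).
have B3 : bounded_mfun
    (fun w => 2^-1 * (Z w * cos (l w + -1 * l' w + (th - th')))).
  by apply: bounded_mfunM => //; exact: bounded_mfun_cst.
rewrite (functionalZD fI)// functionalZ//.
by rewrite (IZ _ _ L1) (IZ _ _ L2) mulr0 addr0.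
Qed.

(** The variable [x = (1 + sin (l + th)) / 2] lies in [0, 1] and is below 1/2 exactly when the sine
    is negative. Its polynomial cutoffs are multipliers and converge to the indicator. *)
Lemma multiplier_sin_lt0 l th : L l ->
  multiplier (fun w => (sin (l w + th) < 0)%R%:R).
Proof.
move=> Ll.
pose x w : R := 2^-1 * cos (l w + (th - pi / 2)) + 2^-1.
have xE w : x w = 2^-1 * sin (l w + th) + 2^-1.
  by rewrite /x -cosBpihalf addrA.
have x01 w : 0 <= x w <= 1.
  by rewrite xE; have := sin_geN1 (l w + th); have := sin_le1 (l w + th); lra.
have mx : multiplier x.
  by apply: multiplierZD; [exact: multiplier_cos|exact: multiplier_cst].
apply: (@multiplier_lim (fun n w => cutoff n (x w)) _ 1).
- move=> n w; have /andP[? ?] := cutoff_itv n (x01 w).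
  by rewrite ger0_norm.
- move=> w; have -> : (sin (l w + th) < 0) = (x w < 2^-1).
    by rewrite xE; apply/idP/idP; lra.
  exact: cutoff_cvg.
- move=> n; rewrite /cutoff; apply: multiplierX.
  under eq_fun do rewrite addrC -mulN1r.
  by apply: multiplierZD; [exact: multiplierX|exact: multiplier_cst].
Qed.

(** At each point the sine of [(l - c) / n.+1] is eventually negative exactly when [l - c] is. *)
Lemma multiplier_lt l c : L l -> multiplier (\1_[set w | l w < c]).
Proof.
move=> Ll.
pose M_ n w : R := (sin (n.+1%:R^-1 * l w + - (c / n.+1%:R)) < 0)%R%:R.
apply: (@multiplier_lim M_ _ 1).
- by move=> n w; rewrite /M_; case: (_ < _); rewrite ?normr1 ?normr0.
- move=> w; apply: cvg_near_cst.
  have := sin_div_sign (l w - c); apply: filterS => n.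
  rewrite subr_lt0 mulrBl [l w / _]mulrC /M_ => ->.
  rewrite indicE; congr (_%:R); congr nat_of_bool.
  by apply/idP/idP; rewrite inE.
- by move=> n; apply: multiplier_sin_lt0; exact: LZ.
Qed.

Let multiplier_set A := measurable A /\ multiplier (\1_A).

(** Complements come from [1 - \1_A]. For a countable union, finite products of the complementary
    indicators are multipliers; at each point they are eventually constant, equal to the indicator
    of the complement of the union. *)
Lemma sigma_algebra_multiplier : sigma_algebra setT multiplier_set.
Proof.
have mC A : multiplier_set A -> multiplier_set (~` A).
  move=> [mA MA]; split; first exact: measurableC.
  have -> : \1_(~` A) = (fun w => -1 * (\1_A w : R) + 1).
    apply/funext => w; rewrite !indicE in_setC.
    by case: (w \in A) => /=; rewrite ?mulr1 ?mulr0 ?addNr ?add0r.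
  by apply: multiplierZD => //; exact: multiplier_cst.
split.
- split=> //; have -> : \1_set0 = (fun=> 0) :> (T -> R).
    by apply/funext => w; rewrite indicE in_set0.
  exact: multiplier_cst.
- by move=> A; rewrite setTD; exact: mC.
- move=> A mA; rewrite -[X in multiplier_set X]setCK; apply: (mC).
  split; first by apply: measurableC; apply: bigcup_measurable => k _; case: (mA k).
  apply: (@multiplier_lim (fun n w => \prod_(k < n) \1_(~` A k) w) _ 1).
  + move=> n w; rewrite normr_prod; apply: prodr_ile1 => i _ /=.
    by rewrite normr_ge0/= indicE; case: (_ \in _); rewrite ?normr1 ?normr0.
  + move=> w; apply: cvg_near_cst; rewrite indicE.
    have [[k _ Ak]|nA] := pselect ((\bigcup_k A k) w).
      rewrite memNset; last by apply; exists k.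
      exists k.+1 => // n /= kn; rewrite (bigD1 (Ordinal kn))//= indicE.
      by rewrite memNset ?mul0r//; apply.
    apply: nearW => n; rewrite mem_set//=; apply: big1 => i _.
    by rewrite indicE mem_set// => Ai; apply: nA; exists i.
  + elim=> [|n IH].
      by under eq_fun do rewrite big_ord0; exact: multiplier_cst.
    under eq_fun do rewrite big_ord_recr/=.
    by apply: multiplierM => //; case: (mC _ (mA n)).
Qed.

(** The sets with a good preimage form a sigma-algebra, which contains the generating rays by
    [multiplier_lt]. *)
Lemma multiplier_preimage l (A : set R) : L l -> measurable A ->
  multiplier_set (l @^-1` A).
Proof.
move=> Ll.
have : sigma_algebra setT (image_set_system setT l multiplier_set).
  exact/sigma_algebra_image/sigma_algebra_multiplier.
move=> sl mA.
have : (@RGenInftyO.G R).-sigma.-measurable A by rewrite -RGenInftyO.measurableE.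
suff /(smallest_sub sl) h : @RGenInftyO.G R `<=` image_set_system setT l multiplier_set.
  by move=> /h; rewrite /image_set_system /= setTI.
move=> _ [c ->]; rewrite /image_set_system /= setTI.
have -> : l @^-1` `]-oo, c[%classic = [set w | l w < c].
  by apply/seteqP; split => w /=; rewrite in_itv.
split; last exact: multiplier_lt.
by have := mL Ll measurableT (measurable_itv `]-oo, c[); rewrite setTI.
Qed.

End trigonometric_class.

(** * Laws on the real line and uniqueness of centred normal laws *)

Section laws.
Context d (T : measurableType d) (R : realType) (P : probability T R).
Implicit Types (X Y : T -> R).

Definition same_law X Y :=
  forall A : set R, measurable A -> P (X @^-1` A) = P (Y @^-1` A).

Lemma same_law_ge0_integral X Y (f : R -> \bar R) :
  measurable_fun setT X -> measurable_fun setT Y -> same_law X Y ->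
  measurable_fun setT f -> (forall x, 0 <= f x)%E ->
  (\int[P]_w f (X w) = \int[P]_w f (Y w))%E.
Proof.
move=> mX mY XY mf f0.
have := ge0_integral_pushforward mX P measurableT mf (fun x _ => f0 x).
have := ge0_integral_pushforward mY P measurableT mf (fun x _ => f0 x).
rewrite !preimage_setT /= => <- <-.
by apply: eq_measure_integral => A mA _; exact: XY.
Qed.

Lemma ge0_integral_law X (f : R -> \bar R)
    (m : {measure set R -> \bar R}) :
  measurable_fun setT X ->
  (forall A : set R, measurable A -> P (X @^-1` A) = m A) ->
  measurable_fun setT f -> (forall x, 0 <= f x)%E ->
  (\int[P]_w f (X w) = \int[m]_y f y)%E.
Proof.
move=> mX Xm mf f0.
have := ge0_integral_pushforward mX P measurableT mf (fun x _ => f0 x).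
rewrite !preimage_setT /= => <-.
by apply: eq_measure_integral => A mA _; exact: Xm.
Qed.

End laws.

(** Open left rays are stable under intersection, generate the Borel sets and exhaust the line, so
    uniqueness of measures applies. *)
Lemma eq_measure_rays (R : realType) (m1 m2 : {measure set (measurableTypeR R) -> \bar R}) :
  (m1 setT < +oo)%E ->
  (forall x : R, m1 `]-oo, x[%classic = m2 `]-oo, x[%classic) ->
  forall A : set R, measurable A -> m1 A = m2 A.
Proof.
move=> m1T m12.
apply: (@measure_unique _ R (measurableTypeR R) (@RGenInftyO.G R)
  (fun n => `]-oo, n%:R[%classic)).
- exact: RGenInftyO.measurableE.
- move=> _ _ [x ->] [y ->]; exists (Num.min x y).
  apply/seteqP; split=> z /=; rewrite !in_itv /= lt_min.
    by move=> [-> ->].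
  by move=> /andP[].
- by move=> n; exists n%:R.
- rewrite -subTset => x _; exists (Num.truncn x).+1 => //=.
  by rewrite in_itv/= truncnS_gt.
- by move=> _ [x ->]; exact: m12.
- move=> k; apply: le_lt_trans m1T; apply: le_measure; rewrite ?inE//.
Qed.

(** Substitute [y = m + s * x] in the integral of the density: the derivative [s] cancels against
    the normalising constant. *)
Lemma normal_prob_ray (R : realType) (m s b : R) : 0 < s ->
  normal_prob m s `]-oo, m + s * b[%classic = normal_prob 0 1 `]-oo, b[%classic.
Proof.
move=> s0; rewrite /normal_prob.
have mpdf m' s' : measurable_fun setT (fun x => (@normal_pdf R m' s' x)%:E).
  by apply/measurable_EFinP; exact: measurable_normal_pdf.
rewrite !integral_itv_bndo_bndc; try exact: measurable_funTS.
pose F x : R := m + s * x.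
have dF (x : R) : is_derive x 1 F s.
  have := is_deriveD (is_derive_cst m x 1) (is_deriveZ s (is_derive_id x 1)).
  by move=> h; apply: (is_derive_eq h); rewrite add0r [_ *: _]mulr1.
have F'E : F^`()%classic = cst s.
  by apply/funext => x; rewrite derive1E; apply: derive_val.
have cF : continuous F.
  move=> x; apply: cvgD; first exact: cvg_cst.
  by apply: cvgMr; exact: cvg_id.
have -> : m + s * b = F b by [].
rewrite increasing_ge0_integration_by_substitutionNy.
- apply: eq_integral => x _; rewrite F'E /= !normal_pdfE ?oner_neq0 ?gt_eqF//.
  rewrite /normal_peak /normal_fun /F.
  transitivity (((Num.sqrt (s ^+ 2 * pi *+ 2))^-1 *
    expR (- (m + s * x - m) ^+ 2 / (s ^+ 2 *+ 2)) * s)%:E); first by [].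
  rewrite !expr1n mul1r mulrAC; congr ((_ * expR _)%:E).
  + rewrite -mulrnAr sqrtrM ?sqr_ge0// sqrtr_sqr gtr0_norm//.
    by rewrite invfM mulrAC mulVf ?gt_eqF// mul1r.
  + by rewrite subr0 addrC addKr; field; rewrite gt_eqF.
- by move=> x y _ _ xy; rewrite /F ltrD2l ltr_pM2l.
- by rewrite F'E => x _; exact: cst_continuous.
- by rewrite F'E; exact: is_cvg_cst.
- by rewrite F'E; exact: cvg_cst.
- split; first by move=> x _; exact: ex_derive.
  by apply: cvg_at_left_filter; exact: cF.
- have : F @ -oo --> -oo by apply: cvg_comp (cvg_addrl_Ny m); apply/gt0_cvgMrNy => //; exact: cvg_id.
  exact.
- apply: continuous_subspaceT => x; apply: continuous_normal_pdf.
  by rewrite gt_eqF.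
- by move=> x _; exact: normal_pdf_ge0.
Qed.

Section normal_moments.
Context d (T : measurableType d) (R : realType) (P : probability T R).
Implicit Types (X Y : T -> R) (m s v : R).

(** This encodes mean zero and variance [v] through integrals of nonnegative functions, so it can be
    evaluated from the law without integrability conditions. *)
Definition centered_square_mean X v := forall c : R,
  (\int[P]_w ((X w - c) ^+ 2)%:E = (v + c ^+ 2)%:E)%E.

Let msqr (c : R) : measurable_fun setT (fun x : R => ((x - c) ^+ 2)%:E).
Proof.
apply/measurable_EFinP; apply: measurable_funX.
exact: measurable_funB.
Qed.

Let sqr_ge0' (c x : R) : (0 <= ((x - c) ^+ 2)%:E)%E.
Proof. by rewrite lee_fin sqr_ge0. Qed.

(** Taking [c = m] gives [v + m ^ 2 = 0], and [c = 0] gives [v = m ^ 2]. *)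
Lemma dirac_moments X m v : measurable_fun setT X ->
  (forall A : set R, measurable A -> P (X @^-1` A) = \d_m A) ->
  centered_square_mean X v -> v = 0 /\ m = 0.
Proof.
move=> mX Xm Xv.
have := Xv m; rewrite (ge0_integral_law mX Xm (msqr m) (sqr_ge0' m)).
rewrite integral_dirac// diracT mul1e subrr expr0n/= => -[h0].
have := Xv 0; rewrite (ge0_integral_law mX Xm (msqr 0) (sqr_ge0' 0)).
rewrite integral_dirac// diracT mul1e subr0 expr0n/= addr0 => -[h1].
have m0 : m ^+ 2 = 0 by lra.
split; first by rewrite -h1.
by apply/eqP; rewrite -sqrf_eq0 m0.
Qed.

(** If [v = 0], then [X] vanishes almost surely; but a nondegenerate normal law is absolutely
    continuous and gives the singleton 0 no mass. *)
Lemma normal_moment_neq0 X m s v : 0 < s -> measurable_fun setT X ->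
  (forall A : set R, measurable A -> P (X @^-1` A) = normal_prob m s A) ->
  centered_square_mean X v -> v != 0.
Proof.
move=> s0 mX Xms Xv; apply/eqP => v0.
have := Xv 0; rewrite v0 expr0n/= addr0.
under eq_integral do rewrite subr0.
move=> I0.
have mX2 : measurable_fun setT (fun w => ((X w) ^+ 2)%:E).
  by apply/measurable_EFinP; exact: measurable_funX.
have /ae_eq_integral_abs : measurable_fun setT (fun w => ((X w) ^+ 2)%:E) by [].
move=> /(_ P measurableT) [+ _].
under eq_integral do rewrite gee0_abs ?lee_fin ?sqr_ge0//.
move=> /(_ I0) aeX.
have P0 : P (X @^-1` [set 0]) = 0%E.
  rewrite Xms//.
  have /null_content_dominatesP := normal_prob_dominates m s.
  by apply => //; exact: lebesgue_measure_set1.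
have mX0 : measurable (X @^-1` [set 0]) by rewrite -[X in measurable X]setTI; exact: mX.
have : P (~` (X @^-1` [set 0])) = 0%E.
  case: aeX => N [mN N0 sN]; apply: (subset_measure0 _ mN _ N0).
    exact: measurableC.
  move=> w /= Xw; apply: sN => /= /(_ I) [] /eqP.
  by rewrite sqrf_eq0 => /eqP.
by rewrite probability_setC// P0 sube0 => -[] /eqP; rewrite oner_eq0.
Qed.

Lemma standardized_normal X m s : 0 < s -> measurable_fun setT X ->
  (forall A : set R, measurable A -> P (X @^-1` A) = normal_prob m s A) ->
  forall A : set R, measurable A ->
    P ((fun w => (X w - m) / s) @^-1` A) = normal_prob 0 1 A.
Proof.
move=> s0 mX Xms.
have mY : measurable_fun setT ((fun w => (X w - m) / s) : T -> measurableTypeR R).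
  by apply: (@measurable_funM _ _ R) => //; exact: measurable_funB.
pose Y : {mfun T >-> measurableTypeR R} := HB.pack (fun w => (X w - m) / s)
  (isMeasurableFun.Build _ _ _ _ _ mY).
suff : forall A : set R, measurable A -> distribution P Y A = normal_prob 0 1 A by [].
apply: eq_measure_rays.
  by apply: le_lt_trans (ltry 1); rewrite -(probability_setT P).
move=> x; apply: (etrans _ (normal_prob_ray m x s0)); rewrite -Xms//.
congr (P _).
apply/seteqP; split => w /=; rewrite !in_itv/= ltr_pdivrMr// ltrBlDl mulrC//.
Qed.

(** No Gaussian moment is computed. Both variables standardize to [normal_prob 0 1], so the
    expectations of [((X - m) / s - u) ^ 2] and of its counterpart for [Y] agree for every [u].
    Comparing these quadratics in [u] gives [m / s = m' / s'] and [v / s ^ 2 = v / s' ^ 2]; since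
    [v != 0], the parameters coincide. *)
Lemma normal_same_law X Y v : normally_distributed P X ->
  normally_distributed P Y -> centered_square_mean X v ->
  centered_square_mean Y v -> same_law P X Y.
Proof.
move=> [mX [m [s [s0 lX]]]] [mY [m' [s' [s0' lY]]]] Xv Yv.
move: lX lY; rewrite /normal_law.
(* A Dirac mass forces [v = 0] and a nondegenerate normal law [v != 0], so the two mixed cases are
   contradictory. *)
have [s_0|sn0] := eqVneq s 0; have [s'_0|s'n0] := eqVneq s' 0 => lX lY.
- have [_ m0] := dirac_moments mX lX Xv.
  have [_ m'0] := dirac_moments mY lY Yv.
  by move=> A mA; rewrite [LHS]lX// [RHS]lY// m0 m'0.
- have [v0 _] := dirac_moments mX lX Xv.
  have s'p : 0 < s' by rewrite lt0r s'n0.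
  by have := normal_moment_neq0 s'p mY lY Yv; rewrite v0 eqxx.
- have [v0 _] := dirac_moments mY lY Yv.
  have sp : 0 < s by rewrite lt0r sn0.
  by have := normal_moment_neq0 sp mX lX Xv; rewrite v0 eqxx.
have sp : 0 < s by rewrite lt0r sn0.
have s'p : 0 < s' by rewrite lt0r s'n0.
have vn0 := normal_moment_neq0 sp mX lX Xv.
have msd (Z : T -> R) (a b : R) : measurable_fun setT Z ->
    measurable_fun setT (fun w => (Z w - a) / b).
  by move=> mZ; apply: measurable_funM => //; exact: measurable_funB.
have GG : same_law P (fun w => (X w - m) / s) (fun w => (Y w - m') / s').
  move=> A mA.
  by rewrite (standardized_normal sp mX lX)// (standardized_normal s'p mY lY).
have moment (Z : T -> R) (a b u : R) : 0 < b -> measurable_fun setT Z ->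
    centered_square_mean Z v ->
    (\int[P]_w (((Z w - a) / b - u) ^+ 2)%:E =
     ((v + (a + b * u) ^+ 2) / b ^+ 2)%:E)%E.
  move=> b0 mZ Zv.
  have bn0 : b != 0 by rewrite gt_eqF.
  have b2 : 0 <= (b ^+ 2)^-1 by rewrite invr_ge0 sqr_ge0.
  transitivity (\int[P]_w ((b ^+ 2)^-1%:E * ((Z w - (a + b * u)) ^+ 2)%:E))%E.
    by apply: eq_integral => w _; rewrite -EFinM; congr (_%:E); field.
  rewrite ge0_integralZl//.
  - by rewrite Zv -EFinM mulrC.
  - by apply: (measurableT_comp (msqr (a + b * u))).
have Q u : (v + (m + s * u) ^+ 2) / s ^+ 2 = (v + (m' + s' * u) ^+ 2) / s' ^+ 2.
  have := same_law_ge0_integral (msd _ m s mX) (msd _ m' s' mY) GG (msqr u) (sqr_ge0' u).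
  by rewrite /= !moment// => -[].
have E u : (v + (m + s * u) ^+ 2) / s ^+ 2 =
    v / s ^+ 2 + (m / s) ^+ 2 + 2 * (m / s) * u + u ^+ 2 by field.
have E' u : (v + (m' + s' * u) ^+ 2) / s' ^+ 2 =
    v / s' ^+ 2 + (m' / s') ^+ 2 + 2 * (m' / s') * u + u ^+ 2 by field.
(* Two values of [u] suffice, as the quadratic coefficient is 1 on both sides. *)
have Q0 := Q 0; have Q1 := Q 1; rewrite !E !E' in Q0 Q1.
have ms : m / s = m' / s' by lra.
have vs : v / s ^+ 2 = v / s' ^+ 2 by rewrite ms in Q0; lra.
have ss : s = s'.
  apply/eqP; rewrite -(@eqrXn2 _ 2)//; apply/eqP/invr_inj.
  exact: (mulfI vn0).
have mm : m = m' by move: ms; rewrite ss => /(mulIf _); apply; rewrite invr_neq0.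
by move=> A mA; rewrite [LHS]lX// [RHS]lY// mm ss.
Qed.

End normal_moments.

(** * Bounded convergence, and laws determined by trigonometric expectations *)

Section bounded_integrals.
Context d (T : measurableType d) (R : realType) (P : probability T R).
Implicit Types (X Y W Z : T -> R).

Lemma bounded_mfun_integrable (f : T -> R) : bounded_mfun f ->
  P.-integrable setT (EFin \o f).
Proof.
move=> [mf [C fC]]; apply: measurable_bounded_integrable => //.
  by rewrite fin_num_fun_lty//; exact: fin_num_measure.
exists C; split; first exact: num_real.
by move=> x Cx w _; rewrite /= (le_trans (fC w))// ltW.
Qed.

Lemma bounded_Rintegral_cvg (f_ : nat -> T -> R) (f : T -> R) (C : R) :
  (forall n, measurable_fun setT (f_ n)) ->
  (forall n w, `|f_ n w| <= C) ->
  (forall w, f_ ^~ w @ \oo --> f w) ->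
  (fun n => \int[P]_w f_ n w) @ \oo --> \int[P]_w f w.
Proof.
move=> mf fC cf.
have bf := bounded_mfun_lim mf fC cf.
have fin := integrable_fin_num measurableT (bounded_mfun_integrable bf).
apply: fine_cvg; rewrite fineK//.
apply: (@dominated_cvg _ _ _ P setT measurableT _ _ (cst C%:E)).
- by move=> n; exact/measurable_EFinP.
- by move=> w _; apply/fine_cvgP; split; [exact: nearW|exact: cf].
- by [].
- exact: (bounded_mfun_integrable (@bounded_mfun_cst _ _ _ C)).
- by move=> n w _; rewrite lee_fin.
Qed.

(** Applied below with [W] the sine of a combination of increments after a fixed time. *)
Lemma weighted_functional W : bounded_mfun W ->
  bounded_functional (fun Z => \int[P]_w (Z w * W w)).
Proof.
move=> bW; split.
- move=> a f g bf bg.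
  under eq_Rintegral do rewrite mulrDl -mulrA.
  rewrite RintegralD//; last 2 first.
  + apply: (@bounded_mfun_integrable (fun w => a * (f w * W w))).
    by apply: bounded_mfunM; [exact: bounded_mfun_cst|exact: bounded_mfunM].
  + by apply: bounded_mfun_integrable; exact: bounded_mfunM.
  rewrite RintegralZl//.
  by apply: bounded_mfun_integrable; exact: bounded_mfunM.
- move=> f_ f C mf fC cf I0; have [mW [D WD]] := bW.
  have : (fun n => \int[P]_w (f_ n w * W w)) @ \oo --> \int[P]_w (f w * W w).
    apply: (@bounded_Rintegral_cvg _ _ (C * D)).
    + by move=> n; exact: measurable_funM.
    + by move=> n w; rewrite normrM ler_pM.
    + by move=> w; apply: cvgM => //; exact: cvg_cst.
  rewrite (_ : (fun _ => _) = cst 0); last by apply/funext => n; exact: I0.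
  by move/(cvg_lim (@Rhausdorff R)) <-; rewrite lim_cst.
Qed.

Lemma law_difference_functional X Y :
  measurable_fun setT X -> measurable_fun setT Y ->
  bounded_functional (fun f : R -> R => \int[P]_w f (X w) - \int[P]_w f (Y w)).
Proof.
move=> mX mY.
have comp (Z : T -> R) (f : R -> R) : measurable_fun setT Z -> bounded_mfun f ->
    bounded_mfun (fun w => f (Z w)).
  by move=> mZ [mf [C fC]]; split; [exact: measurableT_comp|exists C].
have lin (Z : T -> R) a f g : measurable_fun setT Z -> bounded_mfun f ->
    bounded_mfun g -> \int[P]_w (a * f (Z w) + g (Z w)) =
    a * \int[P]_w f (Z w) + \int[P]_w g (Z w).
  move=> mZ /(comp _ _ mZ) bf /(comp _ _ mZ) bg.
  rewrite RintegralD//; last 2 first.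
  + apply: (@bounded_mfun_integrable (fun w => a * f (Z w))).
    by apply: bounded_mfunM; [exact: bounded_mfun_cst|].
  + exact: bounded_mfun_integrable.
  by rewrite RintegralZl//; exact: bounded_mfun_integrable.
split.
- by move=> a f g bf bg; rewrite !lin//; ring.
- move=> f_ f C mf fC cf I0.
  have cvgZ (Z : T -> R) : measurable_fun setT Z ->
      (fun n => \int[P]_w f_ n (Z w)) @ \oo --> \int[P]_w f (Z w).
    move=> mZ; apply: (@bounded_Rintegral_cvg _ _ C).
    + by move=> n; exact: measurableT_comp.
    + by [].
    + by move=> w; exact: cf.
  have h : (fun n => \int[P]_w f_ n (X w) - \int[P]_w f_ n (Y w)) @ \oo -->
      \int[P]_w f (X w) - \int[P]_w f (Y w) by apply: cvgB; exact: cvgZ.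
  move: h; rewrite (_ : (fun _ => _) = cst 0); last by apply/funext => n; exact: I0.
  by move/(cvg_lim (@Rhausdorff R)) <-; rewrite lim_cst.
Qed.

(** Here the class argument replaces uniqueness of Fourier transforms. With [L] the linear functions
    on the line, the difference of the two laws annihilates the constant 1, and indicators of Borel
    sets are multipliers. *)
Lemma same_law_cos X Y : measurable_fun setT X -> measurable_fun setT Y ->
  (forall a th : R, \int[P]_w cos (a * X w + th) = \int[P]_w cos (a * Y w + th)) ->
  same_law P X Y.
Proof.
move=> mX mY XY A mA.
pose L := [set l : R -> R | exists a : R, l = (fun x => a * x)].
have fI := law_difference_functional mX mY.
have [] := @multiplier_preimage _ R R _ L fI _ _ _ id A.
- by move=> _ [a ->]; exact: measurable_funM.
- move=> _ _ [a ->] [b ->]; exists (a + b).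
  by apply/funext => x; rewrite mulrDl.
- move=> a _ [b ->]; exists (a * b).
  by apply/funext => x; rewrite mulrA.
- by exists 1; apply/funext => x; rewrite mul1r.
- by [].
move=> _ [_ /(_ (fun=> 1))[]].
  split; first exact: bounded_mfun_cst.
  move=> _ th [a ->]; apply/eqP; rewrite subr_eq0; apply/eqP.
  under eq_Rintegral do rewrite mul1r.
  by rewrite XY; apply: eq_Rintegral => w _; rewrite mul1r.
(* Testing against the zero linear function with zero phase makes the cosine equal to 1 and leaves
   the probabilities of [A]. *)
move=> _ /(_ (fun x => 0 * x) 0 (ex_intro _ 0 erefl)) /eqP.
rewrite subr_eq0 => /eqP.
have mA' (Z : T -> R) : measurable_fun setT Z -> measurable (Z @^-1` A).
  by move=> mZ; rewrite -[X in measurable X]setTI; exact: mZ.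
have fin (Z : T -> R) : measurable_fun setT Z -> P (Z @^-1` A) \is a fin_num.
  by move=> mZ; apply: fin_num_measure; exact: mA'.
have E (Z : T -> R) : measurable_fun setT Z ->
    \int[P]_w (\1_A (Z w) * 1 * cos (0 * Z w + 0)) = fine (P (Z @^-1` A)).
  move=> mZ; transitivity (\int[P]_w (\1_(Z @^-1` A) w)).
    by apply: eq_Rintegral => w _; rewrite mulr1 mul0r addr0 cos0 mulr1.
  by rewrite /Rintegral integral_indic ?setIT//; exact: mA'.
rewrite (E X mX) (E Y mY) => h.
by rewrite -(fineK (fin X mX)) h (fineK (fin Y mY)).
Qed.

Lemma same_law_integrable X Y (f : R -> R) : measurable_fun setT X ->
  measurable_fun setT Y -> measurable_fun setT f -> same_law P X Y ->
  P.-integrable setT (EFin \o (f \o X)) -> P.-integrable setT (EFin \o (f \o Y)).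
Proof.
move=> mX mY mf XY /integrableP[_ iX]; apply/integrableP; split.
  by apply/measurable_EFinP; exact: measurableT_comp.
apply: le_lt_trans iX.
have mf' : measurable_fun setT (fun x => `|(f x)%:E|%E).
  by apply: measurableT_comp => //; exact/measurable_EFinP.
by rewrite -(same_law_ge0_integral mX mY XY mf').
Qed.

Lemma same_law_integral X Y (f : R -> R) : measurable_fun setT X ->
  measurable_fun setT Y -> measurable_fun setT f -> same_law P X Y ->
  P.-integrable setT (EFin \o (f \o X)) ->
  (\int[P]_w (f (X w))%:E = \int[P]_w (f (Y w))%:E)%E.
Proof.
move=> mX mY mf XY iX.
have iY := same_law_integrable mX mY mf XY iX.
have mEf : measurable_fun setT (EFin \o f) by exact/measurable_EFinP.
have := integral_pushforward mX mEf iX measurableT.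
have := integral_pushforward mY mEf iY measurableT.
rewrite !preimage_setT /= => <- <-.
by apply: eq_measure_integral => A mA _; exact: XY.
Qed.

End bounded_integrals.

Section integrable_real.
Context d (T : measurableType d) (R : realType) (P : probability T R).

Lemma integrable_EFinD (f g : T -> R) : P.-integrable setT (EFin \o f) ->
  P.-integrable setT (EFin \o g) ->
  P.-integrable setT (EFin \o (fun w => f w + g w)).
Proof. by move=> fi gi; exact: (integrableD measurableT fi gi). Qed.

Lemma integrable_EFinZ (a : R) (f : T -> R) : P.-integrable setT (EFin \o f) ->
  P.-integrable setT (EFin \o (fun w => a * f w)).
Proof. by move=> fi; exact: (integrableZl measurableT a fi). Qed.

Lemma EFin_Rintegral (f : T -> R) : P.-integrable setT (EFin \o f) ->
  (\int[P]_w (f w)%:E = (\int[P]_w f w)%:E)%E.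
Proof.
by move=> fi; rewrite /Rintegral fineK//; exact: (integrable_fin_num measurableT fi).
Qed.

End integrable_real.

(** * Moments and laws of linear combinations of Brownian values *)

Section linear_combinations.
Context d (T : measurableType d) (R : realType) (P : probability T R).
Variable B : R -> T -> R.
Hypothesis hB : standard_brownian_motion P B.

(** With lists of coefficient-time pairs, addition is concatenation, while scaling and stopping are
    maps on the entries. *)
Definition lincomb (l : seq (R * R)) (w : T) : R :=
  \sum_(p <- l) p.1 * B p.2 w.

Definition nonneg_times (l : seq (R * R)) : Prop := forall p, p \in l -> 0 <= p.2.

Definition covariance_form (l l' : seq (R * R)) : R :=
  \sum_(p <- l) \sum_(q <- l') p.1 * q.1 * Num.min p.2 q.2.

Lemma brownian_measurable t : 0 <= t -> measurable_fun setT (B t).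
Proof.
move=> t0; have [+ _] := sbm_gaussian hB (fun _ : 'I_1 => t0).
by move=> /(_ ord0).
Qed.

Lemma lincomb_cons p l w : lincomb (p :: l) w = p.1 * B p.2 w + lincomb l w.
Proof. by rewrite /lincomb big_cons. Qed.

Lemma nonneg_times_cons p l : nonneg_times (p :: l) ->
  0 <= p.2 /\ nonneg_times l.
Proof.
move=> pl; split; first by apply: pl; rewrite mem_head.
by move=> q ql; apply: pl; rewrite in_cons ql orbT.
Qed.

Lemma lincomb_normal l : nonneg_times l -> normally_distributed P (lincomb l).
Proof.
move=> l0; pose t (i : 'I_(size l)) := (tnth (in_tuple l) i).2.
have t0 i : 0 <= t i by apply: l0; exact: mem_tnth.
have [_ nl] := sbm_gaussian hB t0.
have -> : lincomb l =
    (fun w => \sum_(i < size l) (tnth (in_tuple l) i).1 * B (t i) w).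
  by apply/funext => w; rewrite /lincomb big_tnth.
exact: nl.
Qed.

Lemma lincomb_measurable l : nonneg_times l -> measurable_fun setT (lincomb l).
Proof. by move=> /lincomb_normal []. Qed.

(** On the diagonal the integrand is nonnegative, so the finite value in [sbm_cov] yields
    integrability; a general product is dominated by the sum of the two squares. *)
Lemma brownian_prod_integrable s t : 0 <= s -> 0 <= t ->
  P.-integrable setT (EFin \o (fun w => B s w * B t w)).
Proof.
move=> s0 t0.
have sq r : 0 <= r -> P.-integrable setT (EFin \o (fun w => B r w * B r w)).
  move=> r0; have mr := brownian_measurable r0.
  apply/integrableP; split; first exact/measurable_EFinP/measurable_funM.
  rewrite (eq_integral (fun w => (B r w * B r w)%:E)); last first.
    by move=> w _; rewrite /= ger0_norm// -expr2 sqr_ge0.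
  by have := sbm_cov hB r0 r0; rewrite unlock => ->; rewrite ltry.
have := integrable_EFinD (sq s s0) (sq t t0).
apply: le_integrable => //.
  by apply/measurable_EFinP/measurable_funM; exact: brownian_measurable.
move=> w _; rewrite /= lee_fin -!expr2.
rewrite [leRHS]ger0_norm ?addr_ge0 ?sqr_ge0//.
have := sqr_ge0 (B s w - B t w); have := sqr_ge0 (B s w + B t w).
have := sqr_ge0 (B s w); have := sqr_ge0 (B t w).
by rewrite ler_norml => *; apply/andP; split; nra.
Qed.

Lemma brownian_integrable t : 0 <= t -> P.-integrable setT (EFin \o B t).
Proof.
move=> t0; have := integrable_EFinD (brownian_prod_integrable t0 t0)
  (bounded_mfun_integrable P (bounded_mfun_cst T 1)).
apply: le_integrable => //; first exact/measurable_EFinP/brownian_measurable.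
move=> w _; rewrite /= lee_fin -expr2 [leRHS]ger0_norm ?addr_ge0 ?sqr_ge0//.
have := sqr_ge0 (B t w - 1); have := sqr_ge0 (B t w + 1).
by rewrite ler_norml => *; apply/andP; split; nra.
Qed.

(** One induction serves all moments: [Z = 1] gives the mean; [Z] a Brownian value, then a
    combination, gives the covariance. *)
Lemma lincomb_prod (Z : T -> R) (c : R -> R) l :
  (forall s, 0 <= s -> P.-integrable setT (EFin \o (fun w => B s w * Z w))) ->
  (forall s, 0 <= s -> \int[P]_w (B s w * Z w) = c s) ->
  nonneg_times l ->
  P.-integrable setT (EFin \o (fun w => lincomb l w * Z w)) /\
  \int[P]_w (lincomb l w * Z w) = \sum_(p <- l) p.1 * c p.2.
Proof.
move=> iZ IZ; elim: l => [_|p l IH /nonneg_times_cons [p0 /IH [il Il]]].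
  have -> : (fun w => lincomb [::] w * Z w) = cst 0.
    by apply/funext => w; rewrite /lincomb big_nil mul0r.
  rewrite big_nil Rintegral_cst// mul0r; split=> //.
  exact: (bounded_mfun_integrable P (bounded_mfun_cst T 0)).
have -> : (fun w => lincomb (p :: l) w * Z w) =
    (fun w => p.1 * (B p.2 w * Z w) + lincomb l w * Z w).
  by apply/funext => w; rewrite lincomb_cons mulrDl mulrA.
have ip := integrable_EFinZ p.1 (iZ _ p0).
split; first exact: integrable_EFinD.
rewrite RintegralD// RintegralZl//; last exact: iZ.
by rewrite IZ// Il big_cons.
Qed.

Lemma lincomb_mean l : nonneg_times l ->
  P.-integrable setT (EFin \o lincomb l) /\ \int[P]_w lincomb l w = 0.
Proof.
move=> l0; have [||i1 I1] := @lincomb_prod (cst 1) (cst 0) l _ _ l0.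
- move=> s s0; under eq_fun do rewrite mulr1.
  exact: brownian_integrable.
- move=> s s0; under eq_Rintegral do rewrite mulr1.
  by rewrite /Rintegral; have := sbm_mean hB s0; rewrite unlock => ->.
have E : (fun w => lincomb l w * cst 1 w) = lincomb l.
  by apply/funext => w; rewrite mulr1.
rewrite E in i1 I1.
by split=> //; rewrite I1 big1// => p _; rewrite mulr0.
Qed.

Lemma lincomb_covariance l l' : nonneg_times l -> nonneg_times l' ->
  P.-integrable setT (EFin \o (fun w => lincomb l w * lincomb l' w)) /\
  \int[P]_w (lincomb l w * lincomb l' w) = covariance_form l l'.
Proof.
move=> l0 l0'.
have H s : 0 <= s ->
    P.-integrable setT (EFin \o (fun w => B s w * lincomb l' w)) /\
    \int[P]_w (B s w * lincomb l' w) = \sum_(q <- l') q.1 * Num.min s q.2.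
  move=> s0; have [||i1 I1] := @lincomb_prod (B s) (fun r => Num.min s r) l' _ _ l0'.
  - by move=> r r0; exact: brownian_prod_integrable.
  - move=> r r0; rewrite minC /Rintegral.
    by have := sbm_cov hB r0 s0; rewrite unlock => ->.
  have -> : (fun w => B s w * lincomb l' w) = (fun w => lincomb l' w * B s w).
    by apply/funext => w; rewrite mulrC.
  by [].
have [i1 ->] := @lincomb_prod (lincomb l') _ l
  (fun s s0 => (H s s0).1) (fun s s0 => (H s s0).2) l0.
split=> //; apply: eq_bigr => p _; rewrite mulr_sumr.
by apply: eq_bigr => q _; rewrite mulrA.
Qed.

Lemma lincomb_centered_square l : nonneg_times l ->
  centered_square_mean P (lincomb l) (covariance_form l l).
Proof.
move=> l0 c; have [i1 I1] := lincomb_mean l0.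
have [i2 I2] := lincomb_covariance l0 l0.
have i3 := integrable_EFinZ (- (2 * c)) i1.
have i4 := bounded_mfun_integrable P (bounded_mfun_cst T (c ^+ 2)).
have E w : (lincomb l w - c) ^+ 2 =
    lincomb l w * lincomb l w + (- (2 * c) * lincomb l w + c ^+ 2) by ring.
under eq_integral do rewrite E.
rewrite EFin_Rintegral; last exact/integrable_EFinD/integrable_EFinD.
rewrite RintegralD//; last exact: integrable_EFinD.
rewrite RintegralD// RintegralZl// I1 I2 mulr0 add0r Rintegral_cst//.
rewrite (_ : fine _ = 1) ?mulr1//.
exact: (congr1 fine (probability_setT P)).
Qed.

Lemma lincomb_same_law l l' : nonneg_times l -> nonneg_times l' ->
  covariance_form l l = covariance_form l' l' ->
  same_law P (lincomb l) (lincomb l').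
Proof.
move=> l0 l0' ll'; apply: (@normal_same_law _ _ _ P _ _ (covariance_form l l)).
- exact: lincomb_normal.
- exact: lincomb_normal.
- exact: lincomb_centered_square.
- by rewrite ll'; exact: lincomb_centered_square.
Qed.

Lemma lincomb_cos l l' th : nonneg_times l -> nonneg_times l' ->
  covariance_form l l = covariance_form l' l' ->
  \int[P]_w cos (lincomb l w + th) = \int[P]_w cos (lincomb l' w + th).
Proof.
move=> l0 l0' ll'.
have ml := lincomb_measurable l0; have ml' := lincomb_measurable l0'.
have mth : measurable_fun setT (fun x : R => x + th) by exact: measurable_funD.
rewrite /Rintegral; congr fine.
apply: (@same_law_integral _ _ _ P _ _ (fun x => cos (x + th)) ml ml').
- by case: (bounded_mfun_cos mth).
- exact: lincomb_same_law.
- by apply: bounded_mfun_integrable; apply: bounded_mfun_cos; exact: measurable_funD.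
Qed.

End linear_combinations.

(** * Bilinear algebra of the covariance *)

Section covariance_form.
Context d (T : measurableType d) (R : realType).
Variable B : R -> T -> R.
Implicit Types (l k : seq (R * R)).

Definition opp_comb l := [seq (- p.1, p.2) | p <- l].

Definition scale_comb (a : R) l := [seq (a * p.1, p.2) | p <- l].

(** This yields the part [X] known at time [s]; subtracting it from the combination of [l] leaves
    the increments [Y] after [s]. *)
Definition stop_comb (s : R) l := [seq (p.1, Num.min s p.2) | p <- l].

Lemma lincomb_cat l k w : lincomb B (l ++ k) w = lincomb B l w + lincomb B k w.
Proof. by rewrite /lincomb big_cat. Qed.

Lemma lincomb_opp l w : lincomb B (opp_comb l) w = - lincomb B l w.
Proof.
rewrite /lincomb big_map /= -sumrN.
by apply: eq_bigr => p _; rewrite mulNr.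
Qed.

Lemma lincomb_scale a l w : lincomb B (scale_comb a l) w = a * lincomb B l w.
Proof.
rewrite /lincomb big_map mulr_sumr.
by apply: eq_bigr => p _; rewrite mulrA.
Qed.

Lemma covariance_form_catl l l' k :
  covariance_form (l ++ l') k = covariance_form l k + covariance_form l' k :> R.
Proof. by rewrite /covariance_form big_cat. Qed.

Lemma covariance_formC l k : covariance_form l k = covariance_form k l :> R.
Proof.
rewrite /covariance_form exchange_big; apply: eq_bigr => p _ /=.
by apply: eq_bigr => q _; rewrite [q.1 * _]mulrC minC.
Qed.

Lemma covariance_form_catr l k k' :
  covariance_form l (k ++ k') = covariance_form l k + covariance_form l k' :> R.
Proof.
by rewrite covariance_formC covariance_form_catl !(covariance_formC l).
Qed.

Lemma covariance_form_oppl l k :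
  covariance_form (opp_comb l) k = - covariance_form l k :> R.
Proof.
rewrite /covariance_form big_map -sumrN; apply: eq_bigr => p _ /=.
by rewrite -sumrN; apply: eq_bigr => q _; rewrite !mulNr.
Qed.

Lemma covariance_form_oppr l k :
  covariance_form l (opp_comb k) = - covariance_form l k :> R.
Proof. by rewrite covariance_formC covariance_form_oppl covariance_formC. Qed.

(** Only the cross terms are sensitive to the sign of [k], and they vanish. *)
Lemma covariance_form_uncorrelated l k : covariance_form l k = 0 :> R ->
  covariance_form (l ++ k) (l ++ k) =
  covariance_form (l ++ opp_comb k) (l ++ opp_comb k) :> R.
Proof.
move=> lk; rewrite !covariance_form_catl !covariance_form_catr.
rewrite !covariance_form_oppl !covariance_form_oppr.
by rewrite (covariance_formC k l) lk; ring.
Qed.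

(* Increments after [s] are uncorrelated with the values up to [s]. *)
Lemma covariance_form_stop s l k : (forall p, p \in k -> p.2 <= s) ->
  covariance_form k (stop_comb s l) = covariance_form k l :> R.
Proof.
move=> ks; rewrite /covariance_form big_seq [RHS]big_seq.
apply: eq_bigr => p /ks ps; rewrite big_map; apply: eq_bigr => q _ /=.
by rewrite minA (min_idPl ps).
Qed.

Lemma nonneg_times_cat l k : nonneg_times l -> nonneg_times k ->
  nonneg_times (l ++ k : seq (R * R)).
Proof. by move=> l0 k0 p; rewrite mem_cat => /orP[/l0|/k0]. Qed.

Lemma nonneg_times_opp l : nonneg_times l -> nonneg_times (opp_comb l).
Proof. by move=> l0 _ /mapP[p /l0 p0 ->]. Qed.

Lemma nonneg_times_stop s l : 0 <= s -> nonneg_times l ->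
  nonneg_times (stop_comb s l).
Proof. by move=> s0 l0 _ /mapP[p /l0 p0 ->] /=; rewrite le_min s0. Qed.

End covariance_form.

(** * Reflection at a deterministic time, on an event of the past *)

Section reflection_at_fixed_time.
Context d (T : measurableType d) (R : realType) (P : probability T R).
Variable B : R -> T -> R.
Hypothesis hB : standard_brownian_motion P B.

(** This handles the null sets among the generators of the filtration. *)
Lemma Rintegral_null_indic (N : set T) (f : T -> R) : measurable N -> P N = 0%E ->
  measurable_fun setT f -> \int[P]_w (\1_N w * f w) = 0.
Proof.
move=> mN N0 mf; rewrite /Rintegral.
rewrite (_ : (fun w => _) = ((fun w => (f w)%:E) \_ N)); last first.
  apply/funext => w; rewrite patchE indicE.
  by case: (w \in N); rewrite ?mul1r ?mul0r.
rewrite -integral_mkcond null_set_integral//.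
by apply: measurable_funTS; exact/measurable_EFinP.
Qed.

Lemma brownian_filtration_measurable s A : 0 <= s ->
  brownian_filtration P B s A -> measurable A.
Proof.
move=> s0; move: A; apply: smallest_sub; first exact: sigma_algebra_measurable.
move=> A [[]//|[r /=]]; rewrite in_itv/= => /andP[r0 _] [C mC <-].
by have := brownian_measurable hB r0; apply.
Qed.

(** The class argument runs with the functional [E[Z sin Y]], where [Y] is the combination [k] of
    increments after [s], and with [L] the combinations of values up to [s]. The constant 1 is
    annihilated, and both kinds of generators of the filtration have multiplier indicators. *)
Lemma filtration_orthogonal s l A th : 0 <= s -> nonneg_times l ->
  brownian_filtration P B s A ->
  \int[P]_w (\1_A w * sin (lincomb B (stop_comb s l) w + th) *
    sin (lincomb B l w - lincomb B (stop_comb s l) w)) = 0.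
Proof.
move=> s0 l0 FA.
have [k kE] : exists k, k = l ++ opp_comb (stop_comb s l) by eexists.
have k0 : nonneg_times k.
  rewrite kE; apply: nonneg_times_cat => //; apply: nonneg_times_opp.
  exact: nonneg_times_stop.
pose past (m : seq (R * R)) := forall p, p \in m -> 0 <= p.2 /\ p.2 <= s.
have past0 m : past m -> nonneg_times m by move=> pm p /pm[].
pose L := [set x | exists2 m, past m & x = lincomb B m].
have bW : bounded_mfun (fun w => sin (lincomb B k w)).
  by apply: bounded_mfun_sin; exact: lincomb_measurable hB _ k0.
have fI := weighted_functional P bW.
have mL x : L x -> measurable_fun setT x.
  by move=> [m /past0 m0 ->]; exact: lincomb_measurable hB _ m0.
have LD x y : L x -> L y -> L (fun w => x w + y w).
  move=> [m pm ->] [n pn ->]; exists (m ++ n).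
    by move=> p; rewrite mem_cat => /orP[/pm|/pn].
  by apply/funext => w; rewrite lincomb_cat.
have LZ a x : L x -> L (fun w => a * x w).
  move=> [m pm ->]; exists (scale_comb a m).
    by move=> _ /mapP[p /pm pp ->].
  by apply/funext => w; rewrite lincomb_scale.
(* For a past [m], the combinations [m + Y] and [m - Y] have the same covariance form, hence the
   same trigonometric expectations. Half the difference of these is the expectation of
   [cos (m + ph) * sin Y]. *)
have a1 : annihilated (fun Z => \int[P]_w (Z w * sin (lincomb B k w))) L (cst 1).
  split; first exact: bounded_mfun_cst.
  move=> _ ph [m pm ->].
  have m0 := past0 m pm.
  have cov0 : covariance_form m k = 0.
    rewrite kE covariance_form_catr covariance_form_oppr covariance_form_stop ?subrr//.
    by move=> p /pm[].
  have cov : covariance_form (m ++ k) (m ++ k) =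
      covariance_form (m ++ opp_comb k) (m ++ opp_comb k).
    exact: covariance_form_uncorrelated.
  have k0' := nonneg_times_opp k0.
  have := lincomb_cos hB (ph - pi / 2) (nonneg_times_cat m0 k0) (nonneg_times_cat m0 k0') cov.
  move=> h.
  have E w : cst 1 w * cos (lincomb B m w + ph) * sin (lincomb B k w) =
      2^-1 * (cos (lincomb B (m ++ k) w + (ph - pi / 2)) -
              cos (lincomb B (m ++ opp_comb k) w + (ph - pi / 2))).
    rewrite !addrA !cosBpihalf !lincomb_cat lincomb_opp.
    have -> : lincomb B m w + lincomb B k w + ph =
      lincomb B m w + ph + lincomb B k w by ring.
    have -> : lincomb B m w - lincomb B k w + ph =
      lincomb B m w + ph - lincomb B k w by ring.
    move: (lincomb B m w + ph) (lincomb B k w) => a b.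
    by rewrite sinD sinB mul1r; field.
  have ic n (n0 : nonneg_times n) :
      P.-integrable setT (EFin \o (fun w => cos (lincomb B n w + (ph - pi / 2)))).
    apply: bounded_mfun_integrable; apply: bounded_mfun_cos.
    by apply: measurable_funD => //; exact: lincomb_measurable hB _ n0.
  rewrite (eq_Rintegral _ (fun w _ => E w)) RintegralZl//; last first.
    have := integrable_EFinD (ic _ (nonneg_times_cat m0 k0))
      (integrable_EFinZ (-1) (ic _ (nonneg_times_cat m0 k0'))).
    by under eq_fun do rewrite mulN1r.
  rewrite RintegralB//; [|exact/ic/nonneg_times_cat|exact/ic/nonneg_times_cat].
  by rewrite h subrr mulr0.
have sA : sigma_algebra setT (fun A => measurable A /\
    multiplier (fun Z => \int[P]_w (Z w * sin (lincomb B k w))) L (\1_A)).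
  exact: (sigma_algebra_multiplier fI mL).
have [_ mA] : measurable A /\
    multiplier (fun Z => \int[P]_w (Z w * sin (lincomb B k w))) L (\1_A).
  move: A FA; apply: (smallest_sub sA) => A [[mA A0]|[r /=]].
    split=> //; split; first exact: bounded_mfun_indic.
    move=> Z [bZ IZ]; split.
      by apply: bounded_mfunM => //; exact: bounded_mfun_indic.
    move=> x ph Lx; have mx := mL _ Lx.
    under eq_Rintegral do rewrite -!mulrA.
    apply: (Rintegral_null_indic mA A0).
    apply: measurable_funM; first by case: bZ.
    apply: measurable_funM; last by case: bW.
    by case: (bounded_mfun_cos (measurable_funD mx (measurable_cst ph))).
  rewrite in_itv/= => /andP[r0 rs] [C mC <-].
  rewrite setTI; apply: (multiplier_preimage fI mL LD LZ) => //.
  (* A single value [B r] with [r <= s] is itself a past combination. *)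
  exists [:: (1, r)]; first by move=> p; rewrite inE => /eqP ->.
  by apply/funext => w; rewrite /lincomb big_seq1 mul1r.
have [_ IA] := mA.2 _ a1.
have Lst : L (lincomb B (stop_comb s l)).
  exists (stop_comb s l) => // _ /mapP[p /l0 p0 ->] /=.
  by rewrite le_min s0 p0 ge_min lexx.
(* The phase shift by [pi / 2] turns the tested cosine into the required sine. *)
rewrite -[RHS](IA _ (th - pi / 2) Lst); apply: eq_Rintegral => w _.
by rewrite addrA cosBpihalf mulr1 kE lincomb_cat lincomb_opp.
Qed.

(** With [u = X + th] and [v = Y], one has [cos (u - v) = cos (u + v) + 2 * sin u * sin v], and the
    last term integrates to zero over [A] by [filtration_orthogonal]. *)
Lemma reflection_at_time s l A th : 0 <= s -> nonneg_times l ->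
  brownian_filtration P B s A ->
  \int[P]_w (\1_A w *
    cos (2 * lincomb B (stop_comb s l) w - lincomb B l w + th)) =
  \int[P]_w (\1_A w * cos (lincomb B l w + th)).
Proof.
move=> s0 l0 FA; have mA := brownian_filtration_measurable s0 FA.
have st0 := nonneg_times_stop s0 l0.
have ml := lincomb_measurable hB l0; have mst := lincomb_measurable hB st0.
have bA := bounded_mfun_indic R mA.
have i1 : P.-integrable setT
    (EFin \o (fun w => \1_A w * cos (lincomb B l w + th))).
  apply: bounded_mfun_integrable; apply: bounded_mfunM => //.
  by apply: bounded_mfun_cos; exact: measurable_funD.
have i2 : P.-integrable setT (EFin \o
    (fun w => \1_A w * sin (lincomb B (stop_comb s l) w + th) *
      sin (lincomb B l w - lincomb B (stop_comb s l) w))).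
  apply: bounded_mfun_integrable; apply: bounded_mfunM.
    by apply: bounded_mfunM => //; apply: bounded_mfun_sin; exact: measurable_funD.
  by apply: bounded_mfun_sin; exact: measurable_funB.
have i3 := integrable_EFinZ 2 i2.
rewrite -[RHS]addr0 -(mulr0 2) -(filtration_orthogonal th s0 l0 FA).
rewrite -RintegralZl// -RintegralD//; apply: eq_Rintegral => w _.
set x := lincomb B (stop_comb s l) w; set y := lincomb B l w.
have -> : 2 * x - y + th = (x + th) - (y - x) by ring.
have -> : y + th = (x + th) + (y - x) by ring.
by move: (x + th) (y - x) => u v; rewrite cosB cosD; ring.
Qed.

End reflection_at_fixed_time.

(** * Limits along continuous paths *)

Section paths.
Context (R : realType).

Lemma cvg_min_cst (T : Type) (F : set_system T) (r a : R) (f : T -> R) :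
  Filter F -> f @ F --> a -> (fun x => Num.min r (f x)) @ F --> Num.min r a.
Proof.
move=> FF fa; rewrite minr_absE.
under eq_fun do rewrite minr_absE.
apply: cvgM; last exact: cvg_cst.
apply: cvgB; first by apply: cvgD => //; exact: cvg_cst.
by apply: cvg_norm; apply: cvgB => //; exact: cvg_cst.
Qed.

(** Paths are continuous only relative to the nonnegative times, so the inner function has to stay
    in [A] along the filter. *)
Lemma within_continuous_cvg (T : Type) (F : set_system T) (f : R -> R)
    (u : T -> R) (a : R) (A : set R) : Filter F ->
  {within A, continuous f} -> F (fun x => A (u x)) -> A a -> u @ F --> a ->
  (fun x => f (u x)) @ F --> f a.
Proof.
move=> FF /subspace_continuousP cf Au Aa ua U /(cf a Aa) /= h.
apply: (@filterS2 _ F FF _ (fun x => A (u x) -> U (f (u x))) _ _ Au).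
  by move=> x Ax; apply.
exact: ua _ h.
Qed.

End paths.

(** * Approximation of the stopping time on a grid *)

Section discretization.
Context d (T : measurableType d) (R : realType) (P : probability T R).
Variables (B : R -> T -> R) (S : T -> \bar R).
Hypothesis hB : standard_brownian_motion P B.
Hypothesis hS : stopping_time (brownian_filtration P B) S.
Variable K : nat.

Lemma brownian_filtration_sub s t : s <= t ->
  brownian_filtration P B s `<=` brownian_filtration P B t.
Proof.
move=> st; apply: sub_sigma_algebra2 => A [NA|[r /= rs BA]]; [by left|right].
exists r => //; move: rs; rewrite /= !in_itv/= => /andP[-> rs]; exact: le_trans rs st.
Qed.

Lemma brownian_filtrationT s : brownian_filtration P B s setT.
Proof.
have [F0 FC _] := @smallest_sigma_algebra T setT ([set N | measurable N /\ P N = 0%E] `|`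
      \bigcup_(s in `[0, s]) preimage_set_system setT (B s) measurable).
by have := FC _ F0; rewrite setD0.
Qed.

Lemma brownian_filtrationD s A C : brownian_filtration P B s A ->
  brownian_filtration P B s C -> brownian_filtration P B s (A `\` C).
Proof.
exact: (@measurableD _ (g_sigma_algebraType _)).
Qed.

(** Truncation removes infinite values and leaves finitely many grid points; up to time [K] it does
    not affect the reflection, by [reflectedE]. *)
Definition truncated w : R := if (K%:R%:E <= S w)%E then K%:R else fine (S w).

Lemma truncated_itv w : 0 <= truncated w <= K%:R.
Proof.
rewrite /truncated; have := hS.1 w; case: ifPn => [_ _|]; first by rewrite ler0n/=.
case: (S w) => [r| |] //=; rewrite ?leey// -ltNge lte_fin lee_fin => rK ->.
by rewrite ltW.
Qed.

(** For [s >= K] the event is the whole space; for [s < K] it is the event that [S] is at most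
    [s]. *)
Lemma truncated_stopping s : 0 <= s ->
  brownian_filtration P B s [set w | truncated w <= s].
Proof.
move=> s0; have [sK|Ks] := ltP s K%:R; last first.
  rewrite (_ : mkset _ = setT); first exact: brownian_filtrationT.
  rewrite -subTset => w _ /=; have /andP[_] := truncated_itv w.
  by move=> /le_trans; apply.
rewrite (_ : mkset _ = [set w | (S w <= s%:E)%E]); first exact: hS.2.
apply/seteqP; split => w /=; rewrite /truncated; have := hS.1 w; case: ifPn => /=.
- by move=> _ _ /(lt_le_trans sK); rewrite ltxx.
- by case: (S w) => [r| |] //=; rewrite ?leey// lee_fin.
- by move=> KS _ Ss; have := le_trans KS Ss; rewrite lee_fin leNgt sK.
- by case: (S w) => [r| |] //=; rewrite ?leey// lee_fin.
Qed.

(** Before the reflection time the right-hand side is [2 * B t - B t], so a single expression, to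
    which path continuity applies, covers both cases. *)
Lemma reflectedE t w : 0 <= t <= K%:R ->
  reflected B S t w = 2 * B (Num.min t (truncated w)) w - B t w.
Proof.
move=> /andP[t0 tK]; rewrite /reflected /truncated; have := hS.1 w.
have [tS|tS] := leP t%:E (S w) => S0.
  rewrite (_ : Num.min _ _ = t); first by rewrite mulrDl mul1r addrK.
  apply/min_idPl; case: ifPn => //; move: tS S0.
  by case: (S w) => [r| |] //=; rewrite ?leey// lee_fin.
have SK : ~~ (K%:R%:E <= S w)%E.
  by rewrite -ltNge; apply: lt_le_trans tS _; rewrite lee_fin.
rewrite (negbTE SK); congr (2 * B _ w - _); apply/esym/min_idPr.
move: tS S0; case: (S w) => [r| |] //=.
by rewrite lte_fin => /ltW.
Qed.

(** Rounding upwards makes the event of index [k] observable at time [grid n k]; rounding down would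
    look into the future. *)
Definition grid_index n w : nat := `|Num.ceil (n.+1%:R * truncated w)|%N.

Definition grid n k : R := k%:R / n.+1%:R.

Lemma grid_ge0 n k : 0 <= grid n k.
Proof. by rewrite divr_ge0. Qed.

Let n1 n : 0 < n.+1%:R :> R. Proof. by rewrite ltr0n. Qed.

Lemma grid_index_le n k w : (grid_index n w <= k)%N = (truncated w <= grid n k).
Proof.
have /andP[t0 _] := truncated_itv w.
have c0 : 0 <= Num.ceil (n.+1%:R * truncated w).
  by rewrite ceil_ge0 (lt_le_trans (ltrN10 _))// mulr_ge0.
rewrite /grid_index -lez_nat gez0_abs// ceil_le_int.
by rewrite /grid ler_pdivlMr// mulrC.
Qed.

Lemma grid_index_bound n w : (grid_index n w < (K * n.+1).+1)%N.
Proof.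
rewrite ltnS grid_index_le /grid natrM mulfK ?gt_eqF//.
by case/andP: (truncated_itv w).
Qed.

Lemma grid_index_event n k :
  brownian_filtration P B (grid n k) [set w | grid_index n w = k].
Proof.
have le j : brownian_filtration P B (grid n j) [set w | (grid_index n w <= j)%N].
  under eq_set do rewrite grid_index_le.
  by apply: truncated_stopping; exact: grid_ge0.
case: k => [|k].
  rewrite (_ : mkset _ = [set w | (grid_index n w <= 0)%N])//.
  by apply/seteqP; split => w /=; rewrite leqn0 => /eqP.
have -> : [set w | grid_index n w = k.+1] =
    [set w | (grid_index n w <= k.+1)%N] `\` [set w | (grid_index n w <= k)%N].
  apply/seteqP; split => w /=; first by move=> ->; rewrite leqnn ltnn.
  move=> [h1 /negP]; rewrite -ltnNge => h2.
  by apply/eqP; rewrite eqn_leq h1.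
apply: brownian_filtrationD => //; apply: brownian_filtration_sub (le k).
by rewrite /grid ler_pM2r ?invr_gt0// ler_nat.
Qed.

(** Rounding up overshoots by at most [1 / n.+1]. *)
Lemma grid_cvg w : (fun n => grid n (grid_index n w)) @ \oo --> truncated w.
Proof.
have /andP[t0 _] := truncated_itv w.
have lo n : truncated w <= grid n (grid_index n w).
  by rewrite -grid_index_le.
have hi n : grid n (grid_index n w) <= truncated w + harmonic n.
  case E : (grid_index n w) => [|k].
    by rewrite /grid mul0r addr_ge0// invr_ge0.
  have : ~~ (grid_index n w <= k)%N by rewrite E ltnn.
  rewrite grid_index_le -ltNge => h.
  by rewrite /grid -natr1 mulrDl mul1r lerD2r ltW.
apply: (@squeeze_cvgr _ _ _ _ (cst (truncated w)) (fun n => truncated w + harmonic n)).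
- by apply: nearW => n; rewrite lo hi.
- exact: cvg_cst.
- rewrite -[X in _ --> X]addr0; apply: cvgD; first exact: cvg_cst.
  exact: cvg_harmonic.
Qed.

(** This is the combination for the process reflected at the rounded time, in the form of
    [reflectedE]. *)
Definition discretized (l : seq (R * R)) n w : R :=
  2 * lincomb B (stop_comb (grid n (grid_index n w)) l) w - lincomb B l w.

(** The function [f] is left free: the identity serves for measurability, a shifted cosine for
    expectations. *)
Lemma discretized_sum l n (f : R -> R) w : f (discretized l n w) =
  \sum_(k < (K * n.+1).+1) \1_[set w | grid_index n w = k] w *
    f (2 * lincomb B (stop_comb (grid n k) l) w - lincomb B l w).
Proof.
rewrite (bigD1 (Ordinal (grid_index_bound n w)))//= big1 ?addr0.
  by rewrite indicE mem_set ?mul1r.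
move=> i ik; rewrite indicE memNset ?mul0r//= => h.
by move: ik; rewrite -val_eqE/= -h eqxx.
Qed.

Lemma discretized_measurable l n : nonneg_times l ->
  measurable_fun setT (discretized l n).
Proof.
move=> l0.
rewrite (_ : discretized l n = fun w => \sum_(k < (K * n.+1).+1)
    \1_[set w | grid_index n w = k] w *
    (2 * lincomb B (stop_comb (grid n k) l) w - lincomb B l w)); last first.
  by apply/funext => w; exact: (discretized_sum l n id).
apply: measurable_sum => k; apply: measurable_funM.
  apply: measurable_indic.
  exact (brownian_filtration_measurable hB (grid_ge0 n k) (@grid_index_event n k)).
apply: measurable_funB; last exact: lincomb_measurable hB _ l0.
apply: measurable_funM => //; apply: (lincomb_measurable hB).
exact: nonneg_times_stop (grid_ge0 n k) l0.
Qed.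

(** On each event of constant index the reflection takes place at a deterministic time whose
    sigma-algebra contains that event, so [reflection_at_time] applies term by term. *)
Lemma discretized_cos l n th : nonneg_times l ->
  \int[P]_w cos (discretized l n w + th) = \int[P]_w cos (lincomb B l w + th).
Proof.
move=> l0; have ml := lincomb_measurable hB l0.
pose E k : set T := [set w | grid_index n w = k].
have FE k := @grid_index_event n k.
have mE k : measurable (E k).
  exact: (brownian_filtration_measurable hB (grid_ge0 n k) (FE k)).
have sumI (g : nat -> T -> R) m : (forall k, bounded_mfun (g k)) ->
    \int[P]_w (\sum_(k < m) \1_(E k) w * g k w) =
    \sum_(k < m) \int[P]_w (\1_(E k) w * g k w) /\
    P.-integrable setT (EFin \o (fun w => \sum_(k < m) \1_(E k) w * g k w)).
  move=> bg; elim: m => [|m [IH iH]].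
    under eq_fun do rewrite big_ord0; rewrite big_ord0.
    rewrite Rintegral_cst// mul0r; split=> //.
    exact: (bounded_mfun_integrable P (bounded_mfun_cst T 0)).
  have im : P.-integrable setT (EFin \o (fun w => \1_(E m) w * g m w)).
    apply: bounded_mfun_integrable; apply: bounded_mfunM => //.
    exact: bounded_mfun_indic.
  have -> : (fun w => \sum_(k < m.+1) \1_(E k) w * g k w) =
     (fun w => \sum_(k < m) \1_(E k) w * g k w + \1_(E m) w * g m w).
    by apply/funext => w; rewrite big_ord_recr.
  split; last exact: integrable_EFinD.
  by rewrite RintegralD// IH big_ord_recr.
have b1 k : bounded_mfun
    (fun w => cos (2 * lincomb B (stop_comb (grid n k) l) w - lincomb B l w + th)).
  apply: bounded_mfun_cos; apply: measurable_funD => //.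
  apply: measurable_funB => //; apply: measurable_funM => //.
  exact: lincomb_measurable hB _ (nonneg_times_stop (grid_ge0 n k) l0).
have b2 (k : nat) : bounded_mfun (fun w => cos (lincomb B l w + th)).
  by apply: bounded_mfun_cos; exact: measurable_funD.
transitivity (\int[P]_w (\sum_(k < (K * n.+1).+1) \1_(E k) w *
    cos (2 * lincomb B (stop_comb (grid n k) l) w - lincomb B l w + th))).
  apply: eq_Rintegral => w _.
  exact: (discretized_sum l n (fun x => cos (x + th))).
rewrite (sumI _ _ b1).1.
under eq_bigr do rewrite (reflection_at_time hB th (grid_ge0 n _) l0 (FE _)).
(* The terms are put back together: exactly one index event occurs at each point. *)
rewrite -(sumI _ _ b2).1; apply: eq_Rintegral => w _.
rewrite (bigD1 (Ordinal (grid_index_bound n w)))//= big1 ?addr0.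
  by rewrite indicE mem_set ?mul1r.
move=> i ik; rewrite indicE memNset ?mul0r//= => h.
by move: ik; rewrite -val_eqE/= -h eqxx.
Qed.

(** The rounded times converge by [grid_cvg], and the path is continuous at the minimum of [p.2] and
    the truncated time. *)
Lemma discretized_cvg l w : (forall p, p \in l -> 0 <= p.2 <= K%:R) ->
  discretized l ^~ w @ \oo --> lincomb (reflected B S) l w.
Proof.
move=> lK.
have -> : lincomb (reflected B S) l w =
    2 * (\sum_(p <- l) p.1 * B (Num.min p.2 (truncated w)) w) - lincomb B l w.
  rewrite /lincomb mulr_sumr -sumrB big_seq [RHS]big_seq.
  by apply: eq_bigr => p /lK pK; rewrite reflectedE// mulrBr mulrCA.
apply: cvgB; last exact: cvg_cst.
apply: cvgM; first exact: cvg_cst.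
have /andP[t0 _] := truncated_itv w.
elim: l lK => [|p l IH] lK.
  rewrite big_nil; under eq_fun do rewrite /lincomb /stop_comb big_nil.
  exact: cvg_cst.
rewrite big_cons; under eq_fun do rewrite /= lincomb_cons.
apply: cvgD; last first.
  by apply: IH => q ql; apply: lK; rewrite in_cons ql orbT.
apply: cvgM; first exact: cvg_cst.
have /andP[p0 _] : 0 <= p.2 <= K%:R by apply: lK; rewrite mem_head.
apply: (@within_continuous_cvg _ _ \oo (fun t => B t w)
  (fun n => Num.min (grid n (grid_index n w)) p.2) _ _ _ (@sbm_continuous _ _ _ _ _ hB w)).
- by exists 0%N => // n _; rewrite /= in_itv/= andbT le_min grid_ge0.
- by rewrite /= in_itv/= andbT le_min p0.
- by under eq_fun do rewrite minC; apply: cvg_min_cst; exact: grid_cvg.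
Qed.

End discretization.

(** * Transfer of the Brownian properties to the reflected process *)

Section reflected_process.
Context d (T : measurableType d) (R : realType) (P : probability T R).
Variables (B : R -> T -> R) (S : T -> \bar R).
Hypothesis hB : standard_brownian_motion P B.
Hypothesis hS : stopping_time (brownian_filtration P B) S.

(** A combination involves finitely many times, so some truncation level leaves its reflection
    unaffected. *)
Lemma nonneg_times_bounded (l : seq (R * R)) : nonneg_times l ->
  exists K : nat, forall p, p \in l -> 0 <= p.2 <= K%:R.
Proof.
elim: l => [|p l IH l0]; first by exists 0%N.
have [p0 /IH [K HK]] := nonneg_times_cons l0.
exists (maxn K (Num.truncn p.2).+1) => q; rewrite in_cons => /predU1P[->|/HK /andP[-> qK]].
  rewrite p0/= (le_trans (ltW (truncnS_gt _)))// ler_nat leq_maxr//.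
by rewrite (le_trans qK)// ler_nat leq_maxl.
Qed.

Lemma reflected_measurable l : nonneg_times l ->
  measurable_fun setT (lincomb (reflected B S) l).
Proof.
move=> l0; have [K lK] := nonneg_times_bounded l0.
apply: (measurable_fun_cvg (h := discretized B S K l)).
  by move=> n; apply: (discretized_measurable hB hS).
by move=> w _; apply: (discretized_cvg hB hS).
Qed.

(** Bounded convergence along the grids: by [discretized_cos] the approximating expectations do not
    depend on [n]. *)
Lemma reflected_cos l th : nonneg_times l ->
  \int[P]_w cos (lincomb (reflected B S) l w + th) =
  \int[P]_w cos (lincomb B l w + th).
Proof.
move=> l0; have [K lK] := nonneg_times_bounded l0.
have : (fun n => \int[P]_w cos (discretized B S K l n w + th)) @ \oo -->
    \int[P]_w cos (lincomb (reflected B S) l w + th).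
  apply: (@bounded_Rintegral_cvg _ _ _ P _ _ 1).
  - move=> n; have md : measurable_fun setT (discretized B S K l n).
      exact: (discretized_measurable hB hS).
    by case: (bounded_mfun_cos (measurable_funD md (measurable_cst th))).
  - by move=> n w; rewrite ler_norml cos_geN1 cos_le1.
  - move=> w; apply: continuous_cvg; first exact: continuous_cos.
    apply: cvgD; last exact: cvg_cst.
    exact: (discretized_cvg hB hS).
rewrite (_ : (fun _ => _) = cst (\int[P]_w cos (lincomb B l w + th))); last first.
  by apply/funext => n; apply: (discretized_cos hB hS).
by move/(cvg_lim (@Rhausdorff R)) <-; rewrite lim_cst.
Qed.

(** Applying [reflected_cos] to every multiple of [l] supplies the hypothesis of [same_law_cos]. *)
Lemma reflected_same_law l : nonneg_times l ->
  same_law P (lincomb B l) (lincomb (reflected B S) l).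
Proof.
move=> l0; apply: same_law_cos.
- exact: lincomb_measurable hB _ l0.
- exact: reflected_measurable.
move=> a th.
have al0 : nonneg_times (scale_comb a l) by move=> _ /mapP[p /l0 p0 ->].
have := reflected_cos th al0.
under eq_Rintegral do rewrite lincomb_scale.
by under [RHS]eq_Rintegral do rewrite lincomb_scale.
Qed.

Lemma reflected_normal l : nonneg_times l ->
  normally_distributed P (lincomb (reflected B S) l).
Proof.
move=> l0; split; first exact: reflected_measurable.
have [_ [m [s [s0 lB]]]] := lincomb_normal hB l0.
exists m, s; split=> // A mA; rewrite -lB//.
exact/esym/reflected_same_law.
Qed.

Lemma lincomb1 (X : R -> T -> R) t : lincomb X [:: (1, t)] = X t.
Proof. by apply/funext => w; rewrite /lincomb big_seq1 mul1r. Qed.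

Lemma reflected_gaussian : gaussian_process P (reflected B S).
Proof.
move=> n t t0; split.
  move=> i; rewrite -(lincomb1 (reflected B S) (t i)); apply: reflected_measurable.
  by move=> p; rewrite inE => /eqP ->; exact: t0.
move=> c; pose l := [seq (c i, t i) | i <- index_enum 'I_n].
rewrite (_ : (fun w => _) = lincomb (reflected B S) l).
  by apply: reflected_normal => _ /mapP[i _ ->]; exact: t0.
by apply/funext => w; rewrite /lincomb big_map.
Qed.

Lemma reflected_mean t : 0 <= t -> ('E_P[reflected B S t] = 0)%E.
Proof.
move=> t0; have l0 : nonneg_times [:: (1, t)].
  by move=> p; rewrite inE => /eqP ->.
have := same_law_integral (lincomb_measurable hB l0) (reflected_measurable l0)
  (@measurable_id _ R setT) (reflected_same_law l0).
rewrite !lincomb1 => /(_ (brownian_integrable hB t0)) h.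
by have := sbm_mean hB t0; rewrite unlock h.
Qed.

Lemma reflected_square l : nonneg_times l ->
  P.-integrable setT (EFin \o (fun w => lincomb (reflected B S) l w ^+ 2)) /\
  \int[P]_w (lincomb (reflected B S) l w ^+ 2) = covariance_form l l.
Proof.
move=> l0; have [il Il] := lincomb_covariance hB l0 l0.
have ml := lincomb_measurable hB l0; have mr := reflected_measurable l0.
have msq : measurable_fun setT (fun x : R => x ^+ 2) by exact: measurable_funX.
have i2 : P.-integrable setT (EFin \o ((fun x => x ^+ 2) \o lincomb B l)).
  rewrite (_ : _ \o lincomb B l = (fun w => lincomb B l w * lincomb B l w))//.
split; first exact: same_law_integrable ml mr msq (reflected_same_law l0) i2.
have := same_law_integral ml mr msq (reflected_same_law l0) i2.
by rewrite -Il /Rintegral => <-.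
Qed.

(** Only laws of single combinations have been compared, so the mixed moment is recovered by
    polarization from the squares of the sum and the difference. *)
Lemma reflected_covariance s t : 0 <= s -> 0 <= t ->
  ('E_P[fun w => (reflected B S s w * reflected B S t w)%R] = (Num.min s t)%:E)%E.
Proof.
move=> s0 t0; pose l (a : R) := [:: (1, s); (a, t)].
have l0 a : nonneg_times (l a).
  by move=> p; rewrite !inE => /orP[]/eqP ->.
have [ip Ip] := reflected_square (l0 1).
have [im Im] := reflected_square (l0 (-1)).
have E w : reflected B S s w * reflected B S t w =
    4^-1 * lincomb (reflected B S) (l 1) w ^+ 2 +
    (- 4^-1) * lincomb (reflected B S) (l (-1)) w ^+ 2.
  by rewrite /lincomb /l !big_cons !big_nil /=; field.
rewrite unlock; under eq_integral do rewrite E.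
have iZp := integrable_EFinZ 4^-1 ip; have iZm := integrable_EFinZ (- 4^-1) im.
rewrite EFin_Rintegral; last exact: integrable_EFinD.
rewrite RintegralD// !RintegralZl// Ip Im; congr (_%:E).
rewrite /covariance_form /l !big_cons !big_nil /= (minC t s).
by field.
Qed.

(** For a finite value [r] of [S w] the path is [2 * B (min r t) - B t], whose continuity follows
    from that of [B]; for an infinite value it is the path of [B]. *)
Lemma reflected_continuous w :
  {within `[0, +oo[, continuous (fun t => reflected B S t w)}.
Proof.
have S0 := hS.1 w; case E : (S w) S0 => [r| |//] S0; last first.
  rewrite (_ : (fun t => _) = (fun t => B t w)).
    exact: (@sbm_continuous _ _ _ _ _ hB w).
  by apply/funext => t; rewrite /reflected E leey.
have r0 : 0 <= r by [].
have -> : (fun t => reflected B S t w) =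
    (fun t => 2 * B (Num.min r t) w - B t w).
  apply/funext => t; rewrite /reflected E lee_fin /=.
  by case: leP => _; rewrite ?mulrDl ?mul1r ?addrK.
have cB := @sbm_continuous _ _ _ _ _ hB w.
apply/subspace_continuousP => x; rewrite /= in_itv/= andbT => x0.
apply: cvgB; last first.
  by have /subspace_continuousP := cB; apply; rewrite /= in_itv/= andbT.
apply: cvgM; first exact: cvg_cst.
apply: (@within_continuous_cvg _ _ _ (fun t => B t w) (Num.min r) _ _ _ cB).
- apply: nearW => t; rewrite /= !in_itv/= !andbT => t0.
  by rewrite le_min r0.
- by rewrite /= in_itv/= andbT le_min r0.
- by apply: cvg_min_cst; apply: cvg_within.
Qed.

End reflected_process.

Theorem theorem2p1 (R : realType) (d : measure_display)
    (Omega : measurableType d) (P : probability Omega R)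
    (B : R -> Omega -> R) (T : Omega -> \bar R)
    (hB : standard_brownian_motion P B)
    (hT : stopping_time (brownian_filtration P B) T) :
  standard_brownian_motion P (reflected B T).
Proof.
split.
- exact: (reflected_gaussian hB hT).
(* As [T] is nonnegative, time 0 falls in the unreflected branch. *)
- by move=> w; rewrite /reflected (hT.1 w); exact: (sbm_start hB).
- by move=> w; apply: (reflected_continuous hB hT).
- by move=> t; apply: (reflected_mean hB hT).
- by move=> s t; apply: (reflected_covariance hB hT).
Qed.
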